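(* Let $D$ be a plane diagram of an oriented link. For each $j\in\mathbb Z$ there is a spectral sequence whose $E_1$-term is given by the cohomology groups $\mathcal H^{s,j-2k}(D)$, $s\in\mathbb Z$, $k\ge 0$ (the group $\mathcal H^{s,j-2k}(D)$ being placed in total degree $s$), and which converges to the cohomology groups $H^{i,j}(D)$, $i\in\mathbb Z$.
   Context: Let $R=\mathbb{Z}[c]$, graded by $\deg(1)=0$, $\deg(c)=2$. Tensor products are over $R$ unless indicated. For a graded $R$-module $N$ let $N\{n\}_i=N_{i+n}$. For a complex $N$ let $N[n]^i=N^{i+n}$ with differential $(-1)^n d^{i+n}$. Let $A$ be the free graded $R$-module with basis $\mathbf{1},X$, $\deg(\mathbf 1)=1$, $\deg(X)=-1$; tensor powers carry the additive grading. Define $R$-linear maps $m:A\otimes A\to A$, a commutative product with unit $\mathbf 1$ and $X^2=0$, and $\Delta:A\to A\otimes A$, $\Delta(\mathbf 1)=\mathbf 1\otimes X+X\otimes\mathbf 1+cX\otimes X$, $\Delta(X)=X\otimes X$. Both have degree $-1$. A plane diagram $D$ is a generic plane projection (finitely many transverse double points, with over/under information). Each double point has two resolutions: the $0$-resolution joins the two regions swept out by rotating the overstrand counterclockwise until it meets the understrand; the $1$-resolution is the other smoothing. For an oriented diagram, $y(D)$ is the number of positive crossings (those whose $0$-resolution is compatible with the orientation) and $x(D)$ is the number of negative crossings (those whose $1$-resolution is compatible with the orientation). Let $\mathcal I$ be the set of double points of $D$. For $\mathcal L\subset\mathcal I$ let $D(\mathcal L)$ be the collection of disjoint simple closed curves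 obtained by taking the $1$-resolution at points of $\mathcal L$ and the $0$-resolution at the other points. Put $V_D(\mathcal L)=A^{\otimes k}\{-|\mathcal L|\}$, with tensor factors indexed by the $k$ circles of $D(\mathcal L)$. For $a\in\mathcal I\setminus\mathcal L$, passing from $D(\mathcal L)$ to $D(\mathcal L\cup\{a\})$ either merges two circles or splits one circle into two; let $\xi_a(\mathcal L):V_D(\mathcal L)\to V_D(\mathcal L\cup\{a\})$ be $m$, respectively $\Delta$, on the corresponding factors and the identity on the other factors (a grading-preserving map). Fix a total order on $\mathcal I$ (different orders give isomorphic complexes). Let $\overline C(D)$ be the complex of graded $R$-modules with $\overline C^i(D)=\bigoplus_{|\mathcal L|=i}V_D(\mathcal L)$ and differential $d(v)=\sum_{a\in\mathcal I\setminus\mathcal L}(-1)^{\#\{b\in\mathcal L:\,b>a\}}\xi_a(\mathcal L)(v)$ for $v\in V_D(\mathcal L)$. Put $C(D)=\overline C(D)[x(D)]\{2x(D)-y(D)\}$, and let $H^{i,j}(D)$ be the $i$-th cohomology group of the degree $j$ subcomplex of $C(D)$. Regard $\mathbb Z$ as a graded $R$-module in degree $0$ with $c\mathbb Z=0$, put $\mathcal C(D)=C(D)\otimes_R\mathbb Z$, a complex of graded abelian groups, and let $\mathcal H^{i,j}(D)$ be the $i$-th cohomology group of the degree $j$ summand of $\mathcal C(D)$. *)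

(* Defs.v *)
From HB Require Import structures.
From mathcomp Require Import all_boot all_order all_algebra.
From mathcomp Require Import boolp.

Set Implicit Arguments.
Unset Strict Implicit.
Unset Printing Implicit Defensive.

Import Order.TTheory GRing.Theory Num.Theory.
Local Open Scope ring_scope.

(** * Subquotients of abelian groups *)

Record sub_of (V : zmodType) (Z : zmodClosed V) :=
  SubOf { sub_val : V; _ : sub_val \in Z }.

HB.instance Definition _ (V : zmodType) (Z : zmodClosed V) :=
  [isSub for @sub_val V Z].
HB.instance Definition _ (V : zmodType) (Z : zmodClosed V) :=
  [Choice of sub_of Z by <:].
HB.instance Definition _ (V : zmodType) (Z : zmodClosed V) :=
  [SubChoice_isSubZmodule of sub_of Z by <:].

Definition trace_sub (V : zmodType) (Z B : zmodClosed V) : {pred sub_of Z} :=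
  fun x => sub_val x \in B.

Arguments trace_sub {V} Z B.

Lemma trace_sub_closed (V : zmodType) (Z B : zmodClosed V) :
  zmod_closed (trace_sub Z B).
Proof.
split=> [|x y]; rewrite /trace_sub !unfold_in; first exact: (rpred0 B).
exact: (@rpredB _ B).
Qed.
HB.instance Definition _ (V : zmodType) (Z B : zmodClosed V) :=
  GRing.isZmodClosed.Build (sub_of Z) (trace_sub Z B) (trace_sub_closed Z B).

(* Z / (Z :&: B), which is Z / B whenever B is contained in Z. *)
Definition subquo (V : zmodType) (Z B : zmodClosed V) : zmodType :=
  Quotient.quot (trace_sub Z B).

Definition add_iso (A B : zmodType) : Prop :=
  exists f : {additive A -> B}, bijective f.

Definition add_ker (A B : zmodType) (f : {additive A -> B}) : {pred A} :=
  fun x => f x == 0.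

Lemma add_ker_closed (A B : zmodType) (f : {additive A -> B}) :
  zmod_closed (add_ker f).
Proof.
split=> [|x y]; rewrite /add_ker !unfold_in ?raddf0 //.
by move=> /eqP fx /eqP fy; rewrite raddfB fx fy subr0.
Qed.
HB.instance Definition _ (A B : zmodType) (f : {additive A -> B}) :=
  GRing.isZmodClosed.Build A (add_ker f) (add_ker_closed f).

Definition add_im (A B : zmodType) (f : {additive A -> B}) (S : zmodClosed A) :
  {pred B} := fun y => `[< exists2 x, x \in S & f x = y >].

Lemma add_im_closed (A B : zmodType) (f : {additive A -> B}) (S : zmodClosed A) :
  zmod_closed (add_im f S).
Proof.
split=> [|y z]; rewrite /add_im !unfold_in.
  by apply/asboolP; exists 0; rewrite ?rpred0 ?raddf0.
move=> /asboolP[x Sx <-] /asboolP[u Su <-]; apply/asboolP.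
by exists (x - u); rewrite ?rpredB ?raddfB.
Qed.
HB.instance Definition _ (A B : zmodType) (f : {additive A -> B})
    (S : zmodClosed A) :=
  GRing.isZmodClosed.Build B (add_im f S) (add_im_closed f S).

Definition add_all (A : zmodType) : {pred A} := fun=> true.
Lemma add_all_closed (A : zmodType) : zmod_closed (@add_all A).
Proof. by []. Qed.
HB.instance Definition _ (A : zmodType) :=
  GRing.isZmodClosed.Build A (@add_all A) (@add_all_closed A).

Definition add_meet (A : zmodType) (S T : zmodClosed A) : {pred A} :=
  fun x => (x \in S) && (x \in T).
Lemma add_meet_closed (A : zmodType) (S T : zmodClosed A) :
  zmod_closed (add_meet S T).
Proof.
split=> [|x y]; first by apply/andP; rewrite !rpred0.
by move=> /andP[? ?] /andP[? ?]; apply/andP; rewrite !rpredB.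
Qed.
HB.instance Definition _ (A : zmodType) (S T : zmodClosed A) :=
  GRing.isZmodClosed.Build A (add_meet S T) (add_meet_closed S T).

(* The homology of A --f--> B --g--> C at B. *)
Definition homology (A B C : zmodType) (f : {additive A -> B})
    (g : {additive B -> C}) : zmodType :=
  subquo (add_ker g) (add_im f (@add_all A)).

(* The i-th cohomology group of the complex whose terms are the subgroups P i
   of V and whose differential is the restriction of d : V -> V. *)
Definition cohomology (V : zmodType) (d : {additive V -> V})
    (P : int -> zmodClosed V) (i : int) : zmodType :=
  subquo (add_meet (add_ker d) (P i)) (add_im d (P (i - 1))).

(** * Spectral sequences (of abelian groups, cohomological, starting at E_1) *)

(* ss_E r p q is E_r^{p,q}, of total degree p + q; only r >= 1 is meaningful.
   To avoid transports along equalities of indices the differential is given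
   between any two terms of a page, and is zero outside bidegree (r, 1 - r). *)
Record spectral_sequence := SpectralSequence {
  ss_E : nat -> int -> int -> zmodType;
  ss_d : forall (r : nat) (p q p' q' : int),
    {additive ss_E r p q -> ss_E r p' q'};
  ss_d_bidegree : forall (r : nat) (p q p' q' : int), (0 < r)%N ->
    ~ (p' = p + r%:Z /\ q' = q + 1 - r%:Z) ->
    forall x, ss_d r p q p' q' x = 0;
  ss_d_square : forall (r : nat) (p q p' q' p'' q'' : int), (0 < r)%N ->
    forall x, ss_d r p' q' p'' q'' (ss_d r p q p' q' x) = 0;
  ss_next : forall (r : nat) (p q : int), (0 < r)%N ->
    add_iso (ss_E r.+1 p q)
      (homology (ss_d r (p - r%:Z) (q - 1 + r%:Z) p q)
                (ss_d r p q (p + r%:Z) (q + 1 - r%:Z)))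
}.

(* E converges to the graded group H: every H n has a finite decreasing
   filtration F, and each E_r^{p,q} is eventually stationary (all differentials
   into and out of it vanish), with stable value gr_F^p H^{p+q}. *)
Definition converges (E : spectral_sequence) (H : int -> zmodType) : Prop :=
  exists F : forall n : int, int -> zmodClosed (H n),
  [/\ forall (n p : int) (x : H n), x \in F n (p + 1) -> x \in F n p,
      forall n : int, exists a b : int,
        (forall x : H n, x \in F n a) /\ (forall x : H n, x \in F n b -> x = 0)
    & forall p q : int, exists2 r0 : nat, (0 < r0)%N &
        forall r : nat, (r0 <= r)%N ->
        [/\ forall (p' q' : int) x, ss_d E r p q p' q' x = 0,
            forall (p' q' : int) x, ss_d E r p' q' p q x = 0
          & add_iso (ss_E E r p q) (subquo (F (p + q) p) (F (p + q) (p + 1)))]].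

(** * Link diagrams *)

(* The four half-edges at a crossing are numbered 0, 1, 2, 3 counterclockwise,
   with 0, 2 on the understrand and 1, 3 on the overstrand. *)
Definition half_edge (n : nat) : finType := ('I_n * 'I_4)%type.

Definition turn (n : nat) (d : half_edge n) : half_edge n := (d.1, d.2 + 1).
Definition opposite (n : nat) (d : half_edge n) : half_edge n := (d.1, d.2 + 2).

(* A plane diagram as a combinatorial plane map: n numbered crossings, m simple
   closed curves without crossings, and the involution matching the two ends of
   each edge. The last field is Euler's formula V - E + F = 2 * #components with
   V = n and E = 2n; the faces are the cycles of turn \o edge. It says that each
   connected component of the underlying 4-valent graph has genus 0. The
   numbering of the crossings is the total order used for the signs. *)
Record diagram := Diagram {
  ncross : nat;
  nloop : nat;
  edge : half_edge ncross -> half_edge ncross;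
  edge_invol : involutive edge;
  edge_irrefl : forall d, edge d != d;
  edge_planar :
    fcard (@turn ncross \o edge) predT =
    (ncross + 2 * n_comp [rel d d' | (d' == turn d) || (d' == edge d)]
                         predT)%N
}.

(* outward d: the strand through the half-edge d leaves the crossing along d. *)
Record orientation (D : diagram) := Orientation {
  outward : half_edge (ncross D) -> bool;
  loop_dir : 'I_(nloop D) -> bool;
  outward_edge : forall d, outward (edge d) = ~~ outward d;
  outward_opposite : forall d, outward (opposite d) = ~~ outward d
}.

(* The half-edge to which d is joined in the b-resolution of its crossing.
   Rotating the overstrand counterclockwise onto the understrand sweeps out the
   corners (1,2) and (3,0). The 0-resolution joins these two regions, so its two
   arcs connect 0 with 1 and 2 with 3; the 1-resolution connects 1 with 2 and
   3 with 0. *)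
Definition smooth (n : nat) (b : bool) (d : half_edge n) : half_edge n :=
  (d.1, if odd d.2 (+) b then d.2 - 1 else d.2 + 1).

Section Cube.
Variable D : diagram.

Definition compatible (o : orientation D) (b : bool) (a : 'I_(ncross D)) :=
  [forall k : 'I_4, outward o (smooth b (a, k)) != outward o (a, k)].

Definition npos (o : orientation D) : nat := #|[set a | compatible o false a]|.
Definition nneg (o : orientation D) : nat := #|[set a | compatible o true a]|.

Definition site : finType := (half_edge (ncross D) + 'I_(nloop D))%type.

Definition resolution_rel (L : {set 'I_(ncross D)}) : rel site := fun s t =>
  match s, t with
  | inl d, inl d' => (d' == edge d) || (d' == smooth (d.1 \in L) d)
  | inr l, inr l' => l == l'
  | _, _ => false
  end.

(* A circle of D(L) is represented by the set of half-edges (or by the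
   crossingless curve) it is made of; thus the circles of D(L) and of D(a |: L)
   that do not pass near a are literally the same. *)
Definition circles (L : {set 'I_(ncross D)}) : {set {set site}} :=
  [set [set t | connect (resolution_rel L) s t] | s : site].

(** * The algebra A over R = Z[c]: false and true stand for the basis elements
    1 and X *)

Definition Zc : comNzRingType := {poly int}.
Definition cvar : Zc := 'X.

(* The coefficient of z in m (x (x) y). *)
Definition m_coef (x y z : bool) : Zc :=
  match x, y with
  | false, false => (~~ z)%:R
  | false, true | true, false => z%:R
  | true, true => 0
  end.

(* The coefficient of y (x) z in Delta x. *)
Definition Delta_coef (x y z : bool) : Zc :=
  match x, y, z with
  | false, false, true | false, true, false => 1
  | false, true, true => cvar
  | true, true, true => 1
  | _, _, _ => 0
  end.

(** * The complexes *)

(* The basis of the direct sum of all V_D(L): a pair (L, S), with S a set of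
   circles of D(L), stands for the basis vector of A^{(x) k} whose factor is X at
   the circles in S and 1 at the other circles of D(L). *)
Definition gen : finType :=
  {g : {set 'I_(ncross D)} * {set {set site}} | g.2 \subset circles g.1}.

Definition gset (g : gen) : {set 'I_(ncross D)} := (val g).1.
Definition gX (g : gen) : {set {set site}} := (val g).2.

(* The coefficient of h in xi_a(g), for a not in gset g and
   gset h = a |: gset g. The last case of the match does not occur, as D is
   planar. *)
Definition xi_coef (g h : gen) : Zc :=
  let K := circles (gset g) in
  let K' := circles (gset h) in
  if gX g :&: (K :&: K') == gX h :&: (K :&: K') then
    match enum (K :\: K'), enum (K' :\: K) with
    | [:: p; q], [:: r] => m_coef (p \in gX g) (q \in gX g) (r \in gX h)
    | [:: p], [:: q; r] => Delta_coef (p \in gX g) (q \in gX h) (r \in gX h)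
    | _, _ => 0
    end
  else 0.

Definition dbar_coef (g h : gen) : Zc :=
  \sum_(a | (a \notin gset g) && (gset h == a |: gset g))
    (-1) ^+ #|[set b in gset g | (a < b)%N]| * xi_coef g h.

(* The sum over all i of the free R-modules C^i(D). *)
Definition chain : lmodType Zc := {ffun gen -> Zc^o}.

Variable o : orientation D.

(* The differential of Cbar(D)[x(D)]. *)
Definition diff_coef (g h : gen) : Zc := (-1) ^+ nneg o * dbar_coef g h.

Definition diff (v : chain) : chain := [ffun h => \sum_g v g * diff_coef g h].

Lemma diff_linear : linear diff.
Proof.
move=> k u v; apply/ffunP=> h; rewrite !ffunE scaler_sumr -big_split /=.
by apply: eq_bigr => g _; rewrite !ffunE mulrDl scalerAl.
Qed.
HB.instance Definition _ :=
  GRing.isLinear.Build Zc chain chain _ diff diff_linear.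

(* The cohomological and internal degrees of a basis vector of
   C(D) = Cbar(D)[x(D)]{2x(D) - y(D)}. The basis vector of A^{(x) k} indexed by S
   has degree k - 2 #|S|, hence degree k - 2 #|S| + #|L| in V_D(L), and each
   shift {n} lowers degrees by n. *)
Definition hdeg (g : gen) : int := #|gset g|%:Z - (nneg o)%:Z.
Definition qdeg (g : gen) : int :=
  #|circles (gset g)|%:Z - 2 * #|gX g|%:Z + #|gset g|%:Z
  - (2 * (nneg o)%:Z - (npos o)%:Z).

(* deg c = 2. *)
Definition homogeneous (n : int) (a : Zc) : Prop :=
  forall k : nat, a`_k != 0 -> 2 * k%:Z = n.

(* The degree j part of C^i(D). *)
Definition chain_part (j i : int) : {pred chain} := fun v =>
  `[< forall g, v g != 0 -> hdeg g = i /\ homogeneous (j - qdeg g) (v g) >].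

Lemma chain_part_closed (j i : int) : zmod_closed (chain_part j i).
Proof.
split=> [|u v]; rewrite /chain_part !unfold_in.
  by apply/asboolP=> g; rewrite ffunE eqxx.
move=> /asboolP Pu /asboolP Pv; apply/asboolP=> g; rewrite !ffunE => nz.
have [u0|u0] := eqVneq (u g) 0; have [v0|v0] := eqVneq (v g) 0.
- by rewrite u0 v0 subr0 eqxx in nz.
- have [-> hv] := Pv g v0; split=> // k; rewrite u0 sub0r coefN oppr_eq0.
  exact: hv.
- by have [-> hu] := Pu g u0; split=> // k; rewrite v0 subr0; apply: hu.
have [-> hu] := Pu g u0; have [_ hv] := Pv g v0; split=> // k; rewrite coefB.
have [u0k|u0k _] := eqVneq ((u g : Zc)`_k) 0; last exact: hu.
by rewrite u0k sub0r oppr_eq0; apply: hv.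
Qed.
HB.instance Definition _ (j i : int) :=
  GRing.isZmodClosed.Build chain (chain_part j i) (chain_part_closed j i).

(* H^{i,j}(D) *)
Definition coh (i j : int) : zmodType := cohomology diff (chain_part j) i.

(* C(D) (x)_R Z, with c acting on Z by 0: the free abelian group on the same
   basis, the differential being the base change of d along c |-> 0. *)
Definition chain0 : zmodType := {ffun gen -> int}.

Definition diff0 (v : chain0) : chain0 :=
  [ffun h => \sum_g v g * (diff_coef g h).[0]].

Lemma diff0_additive : zmod_morphism diff0.
Proof.
move=> u v; apply/ffunP=> h; rewrite !ffunE -sumrB.
by apply: eq_bigr => g _; rewrite !ffunE mulrBl.
Qed.
HB.instance Definition _ :=
  GRing.isZmodMorphism.Build chain0 chain0 diff0 diff0_additive.

Definition chain0_part (j i : int) : {pred chain0} := fun v =>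
  `[< forall g, v g != 0 -> hdeg g = i /\ qdeg g = j >].

Lemma chain0_part_closed (j i : int) : zmod_closed (chain0_part j i).
Proof.
split=> [|u v]; rewrite /chain0_part !unfold_in.
  by apply/asboolP=> g; rewrite ffunE eqxx.
move=> /asboolP Pu /asboolP Pv; apply/asboolP=> g; rewrite !ffunE => nz.
have [u0|/Pu//] := eqVneq (u g) 0; apply: Pv.
by move: nz; rewrite u0 sub0r oppr_eq0.
Qed.
HB.instance Definition _ (j i : int) :=
  GRing.isZmodClosed.Build chain0 (chain0_part j i) (chain0_part_closed j i).

(* \mathcal H^{i,j}(D) *)
Definition coh0 (i j : int) : zmodType := cohomology diff0 (chain0_part j) i.

(* chain0 is indeed C / cC = C (x)_R R/(c), with the induced differential and the
   induced bigrading. *)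
Definition reduce (v : chain) : chain0 := [ffun g => (v g : Zc).[0]].

Lemma reduce_diff v : reduce (diff v) = diff0 (reduce v).
Proof.
apply/ffunP=> h; rewrite !ffunE horner_sum.
by apply: eq_bigr => g _; rewrite !ffunE hornerM.
Qed.

Lemma reduce_ker v : reduce v = 0 <-> exists w : chain, v = cvar *: w.
Proof.
split=> [rv0|[w ->]]; last first.
  by apply/ffunP=> g; rewrite !ffunE hornerM hornerX mul0r.
exists [ffun g => drop_poly 1 (v g : Zc) : Zc^o]; apply/ffunP=> g.
have /ffunP/(_ g) := rv0; rewrite !ffunE horner_coef0 => v0.
rewrite -[LHS](poly_take_drop 1) [X in X + _ = _](_ : _ = 0).
  by rewrite add0r expr1 mulrC.
by apply/polyP=> k; rewrite coef_take_poly coef0; case: k.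
Qed.

Lemma reduce_part j i (w : chain0) :
  w \in chain0_part j i <-> exists2 v, v \in chain_part j i & reduce v = w.
Proof.
split=> [/asboolP Pw|[v /asboolP Pv <-]]; last first.
  apply/asboolP=> g; rewrite ffunE horner_coef0 => nz.
  have [|-> hv] := Pv g; first by apply: contraNneq nz => ->; rewrite coef0.
  by split=> //; apply/esym/eqP; rewrite -subr_eq0 -(hv 0%N nz).
exists [ffun g => (w g)%:P : Zc^o]; last first.
  by apply/ffunP=> g; rewrite !ffunE hornerC.
apply/asboolP=> g; rewrite ffunE polyC_eq0 => nz; have [-> <-] := Pw g nz.
by split=> // -[|k]; rewrite coefC ?eqxx //= subrr.
Qed.

End Cube.

(* Main.v *)
Require Import Defs.
From HB Require Import structures.
From mathcomp Require Import all_boot all_order all_algebra all_fingroup.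
From mathcomp Require Import boolp ring zify.

Set Implicit Arguments.
Unset Strict Implicit.
Unset Printing Implicit Defensive.

Import Order.TTheory GRing.Theory Num.Theory.
Local Open Scope ring_scope.
Local Open Scope quotient_scope.

(** The complex C(D) is filtered by its subcomplexes c ^ p C(D), p >= 0, and the
    spectral sequence is the one of this filtered complex.  In internal degree j
    the filtration is finite ([cfil_bounded]), because c has degree 2 and there
    are finitely many generators; so the spectral sequence converges to the
    cohomology of the degree j part.  Multiplication by c ^ k identifies
    C(D) / c C(D), shifted by the degree 2 k of c ^ k, with the k-th graded
    piece; its inverse is taking the coefficient of c ^ k, which turns d into the
    differential of C(D) (x)_R Z ([coef_diff]).  This identifies the first page
    ([first_page]).

    The construction of the spectral sequence of a filtered complex
    ([filtration_ss], [filtration_ss_converges]) uses nothing about links.  What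
    has to be proved about D is that d preserves the internal degree and raises
    the other one by 1 ([diff_part]), and that d squares to zero ([diff_square]).
    Both are read off from the fact that, D being planar, changing one smoothing
    merges two circles or splits one.

    Planarity enters through [checkerboard].  By Euler's formula, a count of
    ranks over F_2 shows that the faces of the 4-valent graph can be coloured
    with two colours, so that the half-edges are coloured with colours that
    alternate around each vertex and along each edge.  The half-edges of one
    colour are permuted by following the strands of a resolution, the circles
    through crossings are the orbits of that permutation, and changing the
    smoothing at a crossing composes it with a transposition
    ([strand_surgery]).  Hence a surgery always merges two circles or splits one
    ([joined_flip]).

    For the square of d, let X_s be the operator multiplying by X the tensor
    factor of the circle through the point s.  V(L) is generated by its unit
    under the operators X_s ([delta_ind]), and the edge maps of the cube commute
    with them ([xi_mulX]).  So the edge map at a is determined by the image of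
    the unit: it is the unit for a merge, and (X_s + X_t + c X_s X_t) applied to
    the unit for a split, where s and t lie on the two arcs at a ([xi_vac]).  The
    two ways around a face of the cube thus give two products of such factors.
    Counting circles leaves only two cases where the factors differ, and there
    the factors at the two crossings agree on the last vertex of the face
    ([xi_vac_comm]). *)

(** * Maps between subquotients *)

(** Truncating an element outside Z to 0 makes the class map total, so that
    it can be composed with maps of V; it is additive on Z only. *)
Definition cls (V : zmodType) (Z B : zmodClosed V) (x : V) : subquo Z B :=
  \pi_(subquo Z B) (insubd (0 : sub_of Z) x).

Section Subquotients.
Variables (V : zmodType) (Z B : zmodClosed V).

Lemma sub_val_insubd x : x \in Z -> sub_val (insubd (0 : sub_of Z) x) = x.
Proof. by move=> Zx; apply: (insubdK (0 : sub_of Z)). Qed.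

Lemma cls_eq0 x : x \in Z -> (cls Z B x == 0) = (x \in B).
Proof.
move=> Zx; rewrite /cls.
have -> : 0 = \pi_(Quotient.quot (trace_sub Z B)) 0 :> subquo Z B by rewrite raddf0.
rewrite -Quotient.idealrBE subr0.
by rewrite -[RHS](congr1 (fun y => y \in B) (sub_val_insubd Zx)).
Qed.

Lemma cls0 : cls Z B 0 = 0.
Proof. by apply/eqP; rewrite cls_eq0 ?rpred0. Qed.

Lemma clsB : {in Z &, {morph cls Z B : x y / x - y}}.
Proof.
move=> x y Zx Zy; rewrite /cls -raddfB; congr (\pi _).
by apply: val_inj; rewrite raddfB /= !sub_val_insubd ?rpredB.
Qed.

Lemma cls_surj u : exists2 x, x \in Z & cls Z B x = u.
Proof.
elim/quotW: u => y; exists (sub_val y); first exact: (valP y).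
by congr (\pi _); apply: val_inj; rewrite /= sub_val_insubd //; apply: (valP y).
Qed.

Lemma cls_eqP x y : x \in Z -> y \in Z -> (cls Z B x == cls Z B y) = (x - y \in B).
Proof. by move=> Zx Zy; rewrite -cls_eq0 ?rpredB // clsB // subr_eq0. Qed.

End Subquotients.

Section InducedMap.
Variables (V W : zmodType) (Z B : zmodClosed V) (Z' B' : zmodClosed W).
Variable f : V -> W.
Hypothesis fB : {in Z &, {morph f : x y / x - y}}.
Hypothesis fZ : {in Z, forall x, f x \in Z'}.

Lemma subquo_map : {in Z, forall x, x \in B -> f x \in B'} ->
  exists g : {additive subquo Z B -> subquo Z' B'},
    {in Z, forall x, g (cls Z B x) = cls Z' B' (f x)}.
Proof.
move=> fZB; pose r (u : subquo Z B) : V := sub_val (generic_quotient.repr u).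
have rZ u : r u \in Z by apply: (valP (generic_quotient.repr u)).
have rK u : cls Z B (r u) = u.
  by rewrite -[RHS]reprK; congr (\pi _); apply: val_inj; apply: sub_val_insubd.
pose g u := cls Z' B' (f (r u)).
have gE : {in Z, forall x, g (cls Z B x) = cls Z' B' (f x)}.
  move=> x Zx; apply/eqP; rewrite cls_eqP ?fZ // -fB //.
  by apply: fZB; [exact: rpredB | rewrite -(cls_eqP (Z := Z)) // rK].
have g_morph : zmod_morphism g.
  move=> u v; rewrite -[u]rK -[v]rK -clsB // !gE ?rpredB //.
  by rewrite fB // clsB ?fZ.
pose gM := GRing.isZmodMorphism.Build _ _ g g_morph.
pose gA : {additive _ -> _} := HB.pack g gM.
by exists gA.
Qed.

(** The map need only be additive on Z, so it may itself be a class map; this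
    is how a subquotient of a subquotient is compared with a subquotient. *)
Lemma subquo_iso :
  {in Z', forall y, exists2 x, x \in Z & y - f x \in B'} ->
  {in Z, forall x, (f x \in B') = (x \in B)} ->
  add_iso (subquo Z B) (subquo Z' B').
Proof.
move=> f_surj f_inj; have [|g gE] := subquo_map; first by move=> x Zx; rewrite f_inj.
have g_inj : injective g.
  apply: raddf_inj => u; have [x Zx <-] := cls_surj u; rewrite gE // => /eqP.
  by rewrite cls_eq0 ?fZ // f_inj // -(cls_eq0 (Z := Z)) // => /eqP.
have g_surj w : exists u, g u == w.
  have [y Z'y <-] := cls_surj w; have [x Zx yx] := f_surj _ Z'y.
  exists (cls Z B x); rewrite gE // eq_sym cls_eqP ?fZ //.
exists g; exists (fun w => xchoose (g_surj w)) => [u|w].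
  by apply: g_inj; apply/eqP; apply: (xchooseP (g_surj (g u))).
by apply/eqP; apply: (xchooseP (g_surj w)).
Qed.

End InducedMap.

Lemma mem_add_ker (V W : zmodType) (f : {additive V -> W}) x :
  (x \in add_ker f) = (f x == 0).
Proof. by []. Qed.

(** * The spectral sequence of a filtered complex *)

Section FilteredComplex.
Variables (V : zmodType) (d : {additive V -> V}) (P Fil : int -> zmodClosed V).

Definition cyc (p q n : int) : {pred V} :=
  fun x => [&& x \in P n, x \in Fil p & d x \in Fil q].

Lemma cycP p q n x :
  reflect [/\ x \in P n, x \in Fil p & d x \in Fil q] (x \in cyc p q n).
Proof. exact: and3P. Qed.

Lemma cyc_closed p q n : zmod_closed (cyc p q n).
Proof.
split=> [|x y /cycP[? ? ?] /cycP[? ? ?]]; apply/cycP; first by rewrite raddf0 !rpred0.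
by rewrite raddfB !rpredB.
Qed.
HB.instance Definition _ p q n :=
  GRing.isZmodClosed.Build V (cyc p q n) (cyc_closed p q n).

(** The usual denominator Z_{r-1}^{p+1} + d Z_{r-1}^{p-r+1}; the indices of the
    first summand are p + 1 and (p + 1) + (r - 1) = p + r. *)
Definition bnd (r : nat) (p n : int) : {pred V} := fun x =>
  `[< exists2 z, z \in cyc (p - r%:Z + 1) p (n - 1)
               & x - d z \in cyc (p + 1) (p + r%:Z) n >].

Lemma bndP r p n x :
  reflect (exists2 z, z \in cyc (p - r%:Z + 1) p (n - 1)
                    & x - d z \in cyc (p + 1) (p + r%:Z) n)
          (x \in bnd r p n).
Proof. exact: asboolP. Qed.

Lemma bnd_closed r p n : zmod_closed (bnd r p n).
Proof.
split=> [|x y /bndP[z Zz xz] /bndP[t Zt yt]]; apply/bndP.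
  by exists 0; [exact: rpred0 | rewrite raddf0 subr0; exact: rpred0].
exists (z - t); first exact: rpredB.
have -> : x - y - d (z - t) = (x - d z) - (y - d t).
  by rewrite raddfB !opprB [d t - d z]addrC [d t - y]addrC addrACA.
exact: rpredB.
Qed.
HB.instance Definition _ r p n :=
  GRing.isZmodClosed.Build V (bnd r p n) (bnd_closed r p n).

(** Z_r^p / B_r^p in total degree n = p + q, with Z_r^p the elements of filtration
    p whose differential has filtration p + r. *)
Definition page (r : nat) (p q : int) : zmodType :=
  subquo (cyc p (p + r%:Z) (p + q)) (bnd r p (p + q)).

Hypothesis dd : forall x, d (d x) = 0.
Hypothesis dP : forall n x, x \in P n -> d x \in P (n + 1).
Hypothesis dFil : forall (p : int) x, x \in Fil p -> d x \in Fil p.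
Hypothesis FilS : forall (p : int) x, x \in Fil (p + 1) -> x \in Fil p.

Definition goes_to (r : nat) (p q p' q' : int) :=
  (p' == p + r%:Z) && (q' == q + 1 - r%:Z).

(** All terms of all pages are subquotients of V, so the differential between
    any two of them comes from an endomorphism of V. *)
Definition page_fun r p q p' q' (x : V) : V := if goes_to r p q p' q' then d x else 0.

Lemma page_diff_ex r p q p' q' :
  exists g : {additive page r p q -> page r p' q'},
    {in cyc p (p + r%:Z) (p + q), forall x,
      g (cls _ _ x) = cls _ _ (page_fun r p q p' q' x)}.
Proof.
apply: subquo_map => [x y _ _|x|x _]; rewrite /page_fun; case: ifP => [|_].
- by rewrite raddfB.
- by rewrite subr0.
- move=> /andP[/eqP-> /eqP->] /cycP[Px Fx dFx]; apply/cycP; split=> //.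
    by rewrite (_ : _ + _ = p + q + 1); [exact: dP | lia].
  by rewrite dd rpred0.
- by rewrite rpred0.
- move=> /andP[/eqP-> /eqP->] /bndP[z _ xz]; apply/bndP.
  exists (x - d z); last by rewrite raddfB dd subr0 subrr rpred0.
  rewrite (_ : _ - _ + 1 = p + 1) 1?(_ : _ - 1 = p + q) //; lia.
- by rewrite rpred0.
Qed.

Definition page_diff r p q p' q' := sval (cid (page_diff_ex r p q p' q')).

Lemma page_diffE r p q p' q' : {in cyc p (p + r%:Z) (p + q), forall x,
  page_diff r p q p' q' (cls _ _ x) = cls _ _ (page_fun r p q p' q' x)}.
Proof. by rewrite /page_diff; case: cid. Qed.

Lemma page_fun_cyc r p q p' q' x : x \in cyc p (p + r%:Z) (p + q) ->
  page_fun r p q p' q' x \in cyc p' (p' + r%:Z) (p' + q').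
Proof.
rewrite /page_fun /goes_to; case: ifP => [/andP[/eqP-> /eqP->]|_ _]; last exact: rpred0.
case/cycP=> Px Fx dFx; apply/cycP; split=> //; last by rewrite dd rpred0.
by rewrite (_ : _ + _ = p + q + 1); [exact: dP | lia].
Qed.

Lemma page_diff_bidegree r p q p' q' : (0 < r)%N ->
  ~ (p' = p + r%:Z /\ q' = q + 1 - r%:Z) -> forall x, page_diff r p q p' q' x = 0.
Proof.
move=> _ off x; have [y Zy <-] := cls_surj x; rewrite page_diffE // /page_fun.
case: ifP => [/andP[/eqP pE /eqP qE]|_]; last exact: cls0.
by case: off.
Qed.

Lemma page_diff_square r p q p' q' p'' q'' : (0 < r)%N ->
  forall x, page_diff r p' q' p'' q'' (page_diff r p q p' q' x) = 0.
Proof.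
move=> _ x; have [y Zy <-] := cls_surj x; rewrite !page_diffE ?page_fun_cyc //.
by rewrite /page_fun; do !case: ifP => _; rewrite ?dd ?raddf0 cls0.
Qed.

(** The isomorphism sends x to its class on the previous page.  A cocycle x of
    that page satisfies d x = y + d z with z of filtration p + 1 and y of
    filtration p + r + 1, so x - z is in the numerator of the next page and has
    the same class. *)
Lemma page_next r p q : (0 < r)%N ->
  add_iso (page r.+1 p q)
    (homology (page_diff r (p - r%:Z) (q - 1 + r%:Z) p q)
              (page_diff r p q (p + r%:Z) (q + 1 - r%:Z))).
Proof.
move=> _; set n := p + q.
have out x : x \in cyc p (p + r%:Z) n ->
    page_diff r p q (p + r%:Z) (q + 1 - r%:Z) (cls _ _ x) = cls _ _ (d x).
  by move=> Zx; rewrite page_diffE // /page_fun /goes_to !eqxx.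
have inE : p - r%:Z + (q - 1 + r%:Z) = n - 1 by rewrite /n; lia.
have into x : x \in cyc (p - r%:Z) p (n - 1) ->
    page_diff r (p - r%:Z) (q - 1 + r%:Z) p q (cls _ _ x) = cls _ _ (d x).
  move=> Zx; rewrite page_diffE ?inE ?subrK // /page_fun /goes_to subrK eqxx /=.
  by rewrite [_ == _](_ : _ = true) //; apply/eqP; lia.
have dPn x : x \in P (n - 1) -> d x \in P n by move=> /dP; rewrite subrK.
have prS : p + r.+1%:Z = p + r%:Z + 1 by lia.
have FrS x : x \in Fil (p + r.+1%:Z) -> x \in Fil (p + r%:Z).
  by move=> Fx; apply: FilS; rewrite -prS.
have ZS x : x \in cyc p (p + r.+1%:Z) n -> x \in cyc p (p + r%:Z) n.
  by case/cycP=> Px Fx dFx; apply/cycP; split=> //; apply: FrS.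
have dZ x : x \in cyc p (p + r%:Z) n ->
    d x \in cyc (p + r%:Z) (p + r%:Z + r%:Z) (p + r%:Z + (q + 1 - r%:Z)).
  move=> Zx; have := page_fun_cyc (p + r%:Z) (q + 1 - r%:Z) Zx.
  by rewrite /page_fun /goes_to !eqxx.
apply: (subquo_iso (f := cls (cyc p (p + r%:Z) n) (bnd r p n))).
- by move=> x y /ZS Zx /ZS Zy; rewrite clsB.
- move=> x Zx; rewrite mem_add_ker out ?cls_eq0 ?dZ ?ZS //; last first.
  apply/bndP; exists 0; first exact: rpred0.
  rewrite raddf0 subr0.
  have /cycP[Px' Fx' dFx'] := dZ _ (ZS _ Zx).
  apply/cycP; split=> //; case/cycP: Zx => _ _.
  by rewrite prS.
- move=> u; have [x Zx <-] := cls_surj u; rewrite mem_add_ker out // cls_eq0 ?dZ // => /bndP[z].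
  rewrite (_ : _ - _ + 1 = p + 1) 1?(_ : _ - 1 = n); [|by rewrite /n; lia..].
  move=> /cycP[Pz Fz dFz] /cycP[_ xz _]; case/cycP: (Zx) => Px Fx dFx.
  have Zz : z \in cyc p (p + r%:Z) n by apply/cycP; split=> //; apply: FilS.
  exists (x - z).
    apply/cycP; split; rewrite ?rpredB ?raddfB //; first exact: FilS.
    by rewrite prS.
  rewrite -clsB ?rpredB // (_ : x - (x - z) = z); last by rewrite opprB addrC subrK.
  suff -> : cls (cyc p (p + r%:Z) n) (bnd r p n) z = 0 by rewrite rpred0.
  apply/eqP; rewrite cls_eq0 //; apply/bndP; exists 0; first exact: rpred0.
  by rewrite raddf0 subr0; apply/cycP.
- have pr1 : p - r.+1%:Z + 1 = p - r%:Z by lia.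
  move=> x Zx; have [Px Fx dFx] := cycP _ _ _ _ Zx; apply/asboolP/bndP => [[w _]|[z Zz xz]].
    have [y Zy <-] := cls_surj w; rewrite inE subrK in Zy.
    rewrite into // => /esym/eqP; have [Py Fy dFy] := cycP _ _ _ _ Zy.
    have Zdy : d y \in cyc p (p + r%:Z) n.
      apply/cycP; split=> //; last by rewrite dd rpred0.
      exact: dPn.
    rewrite cls_eqP //; last exact: ZS.
    move=> /bndP[z /cycP[Pz Fz dFz] /cycP[Pxz Fxz _]].
    exists (y + z).
      apply/cycP; split; rewrite ?raddfD ?rpredD //.
        by rewrite pr1.
      by rewrite pr1; exact: FilS.
    apply/cycP; rewrite raddfD opprD addrA; split=> //.
    by rewrite !raddfB !dd !subr0.
  have Zz' : z \in cyc (p - r%:Z) p (n - 1).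
    by rewrite -pr1.
  have [Pz Fz dFz] := cycP _ _ _ _ Zz'.
  have Zdz : d z \in cyc p (p + r%:Z) n.
    apply/cycP; split=> //; last by rewrite dd rpred0.
    exact: dPn.
  exists (cls _ _ z) => //; rewrite into //; apply/esym/eqP; rewrite cls_eqP //; last exact: ZS.
  apply/bndP; exists 0; first exact: rpred0.
  rewrite raddf0 subr0; case/cycP: xz => Pxz Fxz dFxz; apply/cycP; split=> //.
  exact: FrS.
Qed.

Definition filtration_ss : spectral_sequence :=
  SpectralSequence page_diff_bidegree page_diff_square page_next.

Hypothesis Fil_le0 : forall (p : int) x, p <= 0 -> x \in Fil p.
Hypothesis Fil_bounded : forall n, exists b, forall x, x \in P n -> x \in Fil b -> x = 0.

Local Notation Hd := (cohomology d P).
Local Notation hcls n := (cls (add_meet (add_ker d) (P n)) (add_im d (P (n - 1)))).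

(** The filtration of the limit: classes that have a cocycle representative in
    the given step of the filtration. *)
Definition coh_fil (n p : int) : {pred Hd n} := fun u =>
  `[< exists2 x, [/\ x \in P n, d x = 0 & x \in Fil p] & hcls n x = u >].

Lemma coh_filP n p u :
  reflect (exists2 x, [/\ x \in P n, d x = 0 & x \in Fil p] & hcls n x = u)
          (u \in @coh_fil n p).
Proof. exact: asboolP. Qed.

Lemma cocycleP n x : reflect (x \in P n /\ d x = 0) (x \in add_meet (add_ker d) (P n)).
Proof.
by apply: (iffP andP) => [[/eqP ? ?]|[? /eqP ?]].
Qed.

Lemma coh_fil_closed n p : zmod_closed (@coh_fil n p).
Proof.
split=> [|u v /coh_filP[x [Px dx Fx] <-] /coh_filP[y [Py dy Fy] <-]]; apply/coh_filP.
  by exists 0; rewrite ?cls0 ?raddf0 ?rpred0.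
exists (x - y); last by rewrite clsB //; apply/cocycleP.
by rewrite raddfB dx dy subrr !rpredB.
Qed.
HB.instance Definition _ n p :=
  GRing.isZmodClosed.Build (Hd n) (@coh_fil n p) (@coh_fil_closed n p).

Lemma Fil_mono p p' x : p <= p' -> x \in Fil p' -> x \in Fil p.
Proof.
move=> le_pp'; rewrite (_ : p' = p + `|p' - p|%N%:Z); last by lia.
elim: `|_|%N => [|k IHk]; first by rewrite addr0.
by move=> Fx; apply: IHk; apply: FilS; rewrite (_ : _ + 1 = p + k.+1%:Z) //; lia.
Qed.

Lemma page_eq0 r p q : (forall x, x \in P (p + q) -> x \in Fil p -> x \in Fil (p + 1)) ->
  forall u : page r p q, u = 0.
Proof.
move=> FilE u; have [x Zx <-] := cls_surj u; apply/eqP; rewrite cls_eq0 //.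
apply/bndP; exists 0; first exact: rpred0.
rewrite raddf0 subr0; case/cycP: Zx => Px Fx dFx; apply/cycP; split=> //.
exact: FilE.
Qed.

Lemma page_lt0 r p q : p < 0 -> forall u : page r p q, u = 0.
Proof. by move=> p0; apply: page_eq0 => x _ _; apply: Fil_le0; lia. Qed.

(** Once p + r passes the end of the filtration in degree n + 1 and p - r is
    negative, Z_r^p consists of the cocycles of filtration p and B_r^p is the sum
    of the cocycles of filtration p + 1 and the coboundaries in filtration p. *)
Lemma filtration_ss_converges : converges filtration_ss Hd.
Proof.
exists (fun n p => @coh_fil n p : zmodClosed (Hd n)); split.
- move=> n p u /coh_filP[x [Px dx Fx] <-]; apply/coh_filP; exists x => //.
  by split=> //; apply: FilS.
- move=> n; have [b bP] := Fil_bounded n; exists 0, b; split=> u.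
    have [x /cocycleP[Px dx] <-] := cls_surj u; apply/coh_filP; exists x => //.
    by split=> //; apply: Fil_le0.
  by case/coh_filP=> x [Px dx Fx] <-; rewrite (bP x) ?cls0.
(* b ends the filtration in the target degree, where d x lives. *)
move=> p q; set n := p + q; have [b bP] := Fil_bounded (n + 1).
exists (`|b|%N + `|p|%N + 1)%N => [|r r_large]; first by rewrite addn1.
have r_b : b <= p + r%:Z by lia.
have r_0 : p - r%:Z < 0 by lia.
split.
- move=> p' q' u; have [y Zy <-] := cls_surj u; rewrite /= page_diffE // /page_fun.
  case: ifP => [/andP[/eqP p'E /eqP q'E]|_]; last exact: cls0.
  have /cycP[Py _ /(Fil_mono r_b) dFy] := Zy.
  by rewrite (bP (d y)) ?cls0 ?dP.
- move=> p' q' u; case E: (goes_to r p' q' p q); last first.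
    by apply: page_diff_bidegree => [|[pE qE]]; [lia | rewrite /goes_to pE qE !eqxx in E].
  case/andP: E => /eqP pE _; rewrite (_ : u = 0) ?raddf0 //; apply: page_lt0; lia.
have Zd x : x \in cyc p (p + r%:Z) n -> d x = 0.
  by case/cycP=> Px _ /(Fil_mono r_b) dFx; apply: bP => //; apply: dP.
have Zcoc x : x \in cyc p (p + r%:Z) n -> x \in add_meet (add_ker d) (P n).
  by move=> Zx; apply/cocycleP; split; [case/cycP: Zx | exact: Zd].
apply: (subquo_iso (f := hcls n)).
- by move=> x y /Zcoc Zx /Zcoc Zy; rewrite clsB.
- move=> x Zx; apply/coh_filP; exists x => //.
  by split; [case/cycP: Zx | exact: Zd | case/cycP: Zx].
- move=> u /coh_filP[x [Px dx Fx] <-]; exists x; last by rewrite subrr rpred0.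
  by apply/cycP; split=> //; rewrite dx rpred0.
- move=> x Zx; apply/coh_filP/bndP => [[y [Py dy Fy]]|[z /cycP[Pz Fz dFz] /cycP[Pxz Fxz dFxz]]].
    have Cy : y \in add_meet (add_ker d) (P n) by apply/cocycleP.
    move/eqP; rewrite eq_sym cls_eqP //; last exact: Zcoc.
    case/asboolP=> z Pz dz; exists z.
      apply/cycP; split=> //; first by apply: Fil_le0; lia.
      by rewrite dz rpredB //; [case/cycP: Zx | exact: FilS].
    by rewrite dz opprB addrC subrK; apply/cycP; rewrite dy rpred0.
  have Zxz : x - d z \in add_meet (add_ker d) (P n).
    by apply/cocycleP; split=> //; rewrite raddfB dd subr0 Zd.
  exists (x - d z); first by split=> //; case/cocycleP: Zxz.
  apply/eqP; rewrite cls_eqP //; last exact: Zcoc.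
  rewrite addrAC subrr sub0r rpredN.
  by apply/asboolP; exists z.
Qed.

End FilteredComplex.

(** * Checkerboard colourings of plane diagrams *)

(** Functions on T are row vectors indexed by the enumeration of T, so that the
    rank theory of matrices applies to them. *)
Section FunctionSpaces.
Variables (F : fieldType) (T : finType).
Local Notation N := #|T|.
Implicit Types (x : 'rV[F]_N) (u v : T -> T).

Definition at_pt x (d : T) : F := x 0 (enum_rank d).

Lemma at_ptP x y : (forall d, at_pt x d = at_pt y d) -> x = y.
Proof. by move=> xy; apply/rowP=> j; have := xy (enum_val j); rewrite /at_pt enum_valK. Qed.

Lemma at_ptB x y d : at_pt (x - y) d = at_pt x d - at_pt y d.
Proof. by rewrite /at_pt !mxE. Qed.

Definition precomp_mx u : 'M[F]_N := \matrix_(i, j) (i == enum_rank (u (enum_val j)))%:R.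

Lemma precomp_mxE x u d : at_pt (x *m precomp_mx u) d = at_pt x (u d).
Proof.
rewrite /at_pt mxE (bigD1 (enum_rank (u d))) //= big1 ?addr0 => [|i /negPf i_ne].
  by rewrite mxE enum_rankK eqxx mulr1.
by rewrite mxE enum_rankK i_ne mulr0.
Qed.

Lemma precomp_mx_comp u v : precomp_mx u *m precomp_mx v = precomp_mx (u \o v).
Proof.
apply/row_matrixP=> i; apply: at_ptP => d.
by rewrite row_mul !rowE -mulmxA !mulmxA !precomp_mxE.
Qed.

Lemma precomp_mx_tr u v : cancel u v -> cancel v u -> (precomp_mx u)^T = precomp_mx v.
Proof.
move=> uK vK; apply/matrixP=> i j; rewrite !mxE; congr (_%:R); congr nat_of_bool.
rewrite -(inj_eq enum_val_inj) enum_rankK -[in RHS](inj_eq enum_val_inj) enum_rankK.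
by apply/eqP/eqP=> ->; rewrite ?uK ?vK.
Qed.

(** A function invariant along e is determined by its values at the roots of the
    components, so the indicator functions of the components form a basis. *)
Lemma rank_invariants m (A : 'M[F]_(m, N)) (e : rel T) : connect_sym e ->
  (forall x, (x <= A)%MS <-> (forall d d', e d d' -> at_pt x d = at_pt x d')) ->
  \rank A = n_comp e T.
Proof.
move=> e_sym AP; have rootsT: n_comp e T = #|roots e|.
  by apply: eq_card => d; rewrite !inE andbT.
pose B : 'M[F]_(#|roots e|, N) :=
  \matrix_(i, j) (fingraph.root e (enum_val j) == enum_val i)%:R.
pose C : 'M[F]_(N, #|roots e|) := \matrix_(j, i) (enum_val j == enum_val i)%:R.
have BC : B *m C = 1%:M.
  apply/matrixP=> i i'; rewrite !mxE (bigD1 (enum_rank (enum_val i'))) //= big1.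
    rewrite addr0 !mxE enum_rankK eqxx mulr1 (eqP (enum_valP i')).
    by rewrite (inj_eq enum_val_inj) eq_sym.
  move=> j j_ne; rewrite !mxE [enum_val j == _]negbTE ?mulr0 //.
  by apply: contraNneq j_ne => <-; rewrite enum_valK.
have freeB : row_free B by apply/row_freeP; exists C.
have AB : (A == B)%MS.
  apply/andP; split; last first.
    apply/row_subP=> i; apply/AP=> d d' edd'; rewrite /at_pt !mxE !enum_rankK.
    by rewrite (eqP (_ : fingraph.root e d == fingraph.root e d')) // root_connect // connect1.
  apply/row_subP=> i; have /AP inv_i := row_sub i A.
  have inv_root d : at_pt (row i A) (fingraph.root e d) = at_pt (row i A) d.
    have /connectP[s] := connect_root e d; elim: s d (fingraph.root e d) => [|d' s IHs] d r /=.
      by move=> _ ->.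
    by move=> /andP[edd' path_s] rE; rewrite (inv_i _ _ edd'); apply: IHs.
  apply/submxP; exists (\row_k at_pt (row i A) (enum_val k)); apply: at_ptP => d.
  have rd : fingraph.root e d \in roots e by rewrite inE roots_root.
  rewrite -inv_root /at_pt [RHS]mxE (bigD1 (enum_rank_in rd (fingraph.root e d))) //= big1.
    by rewrite addr0 !mxE enum_rankK enum_rankK_in // eqxx mulr1.
  move=> k k_ne; rewrite !mxE enum_rankK [_ == enum_val k]negbTE ?mulr0 //.
  by apply: contraNneq k_ne => rk; apply/eqP/enum_val_inj; rewrite enum_rankK_in.
by rewrite rootsT (eqmx_rank AB); apply/eqP.
Qed.

End FunctionSpaces.

Lemma connect_sym_steps (T : finType) (e : rel T) :
  (forall x y, e x y -> connect e y x) -> connect_sym e.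
Proof.
move=> back; suff imp x y : connect e x y -> connect e y x.
  by move=> x y; apply/idP/idP; apply: imp.
case/connectP=> s; elim: s x => [|z s IHs] x /=; first by move=> _ ->.
by move=> /andP[/back zx path_s] /(IHs z path_s) yz; apply: connect_trans yz zx.
Qed.

Section Checkerboard.
Variable D : diagram.
Local Notation n := (ncross D).
Local Notation T := (half_edge n).
Local Notation F := 'F_2.
Local Notation N := #|{: T}|.

Lemma turn4 (d : T) : turn (turn (turn (turn d))) = d.
Proof.
case: d => a k; rewrite /turn /= -!addrA; congr (_, _); apply: val_inj.
by case: k => [[|[|[|[|]]]]].
Qed.

Lemma turn_inj : injective (@turn n).
Proof. exact: (can_inj (g := fun d => turn (turn (turn d))) turn4). Qed.

Lemma edge_inj : injective (@edge D).
Proof. exact: inv_inj (@edge_invol D). Qed.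

Definition face (d : T) : T := turn (edge d).

Lemma face_inj : injective face.
Proof. by move=> d d' /turn_inj/edge_inj. Qed.

Definition map_rel : rel T := [rel d d' | (d' == turn d) || (d' == edge d)].

Lemma map_rel_turn d : map_rel d (turn d).
Proof. by rewrite /map_rel /= eqxx. Qed.

Lemma map_rel_edge d : map_rel d (edge d).
Proof. by rewrite /map_rel /= eqxx orbT. Qed.

Lemma map_rel_sym : connect_sym map_rel.
Proof.
apply: connect_sym_steps => d d' /orP[]/eqP->; last first.
  by rewrite connect1 // -{2}[d]edge_invol map_rel_edge.
rewrite -[X in connect _ _ X]turn4.
have step x : connect map_rel x (turn x); first exact/connect1/map_rel_turn.
exact: connect_trans (step _) (connect_trans (step _) (step _)).
Qed.

(** The row space of [vertex_mx] is the space of functions that are constant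
    around vertices, that of [face_mx] the functions constant on faces; right
    multiplication by [vertex_mx^T] sums a function around each vertex, and by
    [edge_diff] takes its differences along edges. *)
Definition vertex_mx : 'M[F]_(n, N) := \matrix_(i, j) ((enum_val j : T).1 == i)%:R.
Definition face_mx : 'M[F]_N := kermx (1%:M - precomp_mx F face).
Definition edge_diff : 'M[F]_N := 1%:M - precomp_mx F (@edge D).

Lemma edge_diffE x d : at_pt (x *m edge_diff) d = at_pt x d - at_pt x (edge d).
Proof. by rewrite mulmxBr mulmx1 at_ptB precomp_mxE. Qed.

Lemma ker_precomp (u : T -> T) x :
  (x <= kermx (1%:M - precomp_mx F u))%MS <-> (forall d, at_pt x d = at_pt x (u d)).
Proof.
split=> [/sub_kermxP|xu]; last first.
  apply/sub_kermxP; rewrite mulmxBr mulmx1; apply/eqP; rewrite subr_eq0; apply/eqP.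
  by apply: at_ptP => d; rewrite precomp_mxE.
by rewrite mulmxBr mulmx1 => /eqP; rewrite subr_eq0 => /eqP xE d; rewrite {1}xE precomp_mxE.
Qed.

Lemma vertex_mxP x : (x <= vertex_mx)%MS <-> (forall d, at_pt x d = at_pt x (turn d)).
Proof.
split=> [/submxP[y ->] d|xt].
  by rewrite /at_pt !mxE; apply: eq_bigr => i _; rewrite !mxE !enum_rankK.
apply/submxP; exists (\row_i at_pt x (i, 0)); apply: at_ptP => -[a k].
rewrite /at_pt mxE (bigD1 a) //= big1 => [|i /negPf ia]; last first.
  by rewrite !mxE enum_rankK eq_sym ia mulr0.
rewrite addr0 !mxE enum_rankK eqxx mulr1.
suff xk : at_pt x (a, k) = at_pt x (a, 0) by exact: xk.
have -> : k = inord k :> 'I_4 by rewrite inord_val.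
elim: (val k) (ltn_ord k) => [_|m IHm m4].
  by congr (at_pt x (_, _)); apply: val_inj; rewrite /= inordK.
rewrite -(IHm (ltnW m4)) [RHS]xt; congr (at_pt x (_, _)); apply: val_inj.
by rewrite /= !inordK //; [rewrite (@modn_small 1) // modn_small addn1|exact: ltnW].
Qed.

Lemma rank_vertex_mx : \rank vertex_mx = n.
Proof.
apply/eqP/row_freeP; exists (\matrix_(j, i) (enum_val j == (i, 0) :> T)%:R).
apply/matrixP=> i i'; rewrite !mxE (bigD1 (enum_rank ((i', 0) : T))) //= big1.
  by rewrite !mxE enum_rankK eqxx mulr1 addr0 eq_sym.
move=> j j_ne; rewrite !mxE [enum_val j == _]negbTE ?mulr0 //.
by apply: contraNneq j_ne => <-; rewrite enum_valK.
Qed.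

Lemma rank_face_mx : \rank face_mx = fcard face T.
Proof.
apply: rank_invariants => [|x]; first exact: (fconnect_sym face_inj).
rewrite ker_precomp; split=> [xf d d' /eqP <-|xf d] //.
by apply: xf; rewrite /= eqxx.
Qed.

(** A function invariant under turning and along edges is constant on the
    components of the graph. *)
Lemma rank_cap_edge m (A : 'M[F]_(m, N)) :
  (forall x, (x <= A)%MS -> (x <= kermx edge_diff)%MS ->
     forall d, at_pt x d = at_pt x (turn d)) ->
  (forall x, (forall d, at_pt x d = at_pt x (turn d)) ->
     (x <= kermx edge_diff)%MS -> (x <= A)%MS) ->
  \rank (A :&: kermx edge_diff)%MS = n_comp map_rel T.
Proof.
move=> A_turn turn_A; apply: rank_invariants => [|x]; first exact: map_rel_sym.
rewrite sub_capmx; split=> [/andP[Ax Ex] d d' /orP[]/eqP->|xinv].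
- exact: A_turn.
- by have /ker_precomp-> := Ex.
have Ex : (x <= kermx edge_diff)%MS.
  by apply/ker_precomp => d; apply/xinv/map_rel_edge.
rewrite Ex andbT; apply: turn_A => // d; exact/xinv/map_rel_turn.
Qed.

Lemma card_half_edge : N = (4 * n)%N.
Proof. by rewrite card_prod !card_ord mulnC. Qed.

Lemma edge_diff_tr : edge_diff^T = edge_diff.
Proof.
by rewrite /edge_diff linearB /= trmx1 (precomp_mx_tr _ (@edge_invol D) (@edge_invol D)).
Qed.

(** In characteristic 2 differences along edges are invariant along edges, so
    the image of [edge_diff] lies in its kernel. *)
Lemma rank_edge_diff : (\rank edge_diff <= 2 * n)%N.
Proof.
have sq0 : edge_diff *m edge_diff = 0.
  apply/row_matrixP=> i; rewrite row0 row_mul; apply: at_ptP => d.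
  rewrite edge_diffE /at_pt !mxE !enum_rankK edge_invol.
  by case: (i == enum_rank d); case: (i == _); apply: val_inj.
have := mulmx0_rank_max sq0; have := card_half_edge; lia.
Qed.

(** For a function x constant on faces, x (edge d) = x (turn d), so around a
    vertex the differences x d - x (edge d) telescope. *)
Lemma vertex_face0 : face_mx *m edge_diff *m vertex_mx^T = 0.
Proof.
have fE : face_mx *m precomp_mx F (@edge D) = face_mx *m precomp_mx F (@turn n).
  have {1}-> : face_mx = face_mx *m precomp_mx F face.
    by have /eqP := mulmx_ker (1%:M - precomp_mx F face);
       rewrite mulmxBr mulmx1 subr_eq0 => /eqP.
  rewrite -mulmxA precomp_mx_comp; congr (_ *m _).
  by apply/matrixP=> i j; rewrite !mxE /face /= edge_invol.
have tE : precomp_mx F (@turn n) *m vertex_mx^T = vertex_mx^T.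
  apply: trmx_inj; rewrite trmx_mul trmxK.
  rewrite (precomp_mx_tr F (v := fun d => turn (turn (turn d))) turn4); last first.
    exact: turn4.
  apply/row_matrixP=> i; rewrite row_mul; apply: at_ptP => d.
  by rewrite precomp_mxE /at_pt !mxE !enum_rankK.
by rewrite mulmxBr mulmx1 fE mulmxBl -(mulmxA face_mx) tE subrr.
Qed.

Lemma ones_edge : ((const_mx 1 : 'rV_N) <= edge_diff)%MS.
Proof.
(* x is 1 at the end of each edge whose other end comes first. *)
apply/submxP; exists (\row_j (enum_rank (edge (enum_val j : T)) < j)%N%:R).
apply: at_ptP => d; rewrite edge_diffE /at_pt !mxE !enum_rankK edge_invol.
have := @edge_irrefl D d; rewrite -(inj_eq enum_rank_inj) -val_eqE /=.
by case: ltngtP => // _ _; apply: val_inj.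
Qed.

(** Each vertex has four half-edges, and 4 = 0 in F_2. *)
Lemma ones_vertex : ((const_mx 1 : 'rV_N) <= kermx vertex_mx^T)%MS.
Proof.
apply/sub_kermxP/rowP=> i; rewrite !mxE.
rewrite (reindex_onto (enum_rank : T -> 'I_N) enum_val) /=; last by move=> j; rewrite enum_valK.
rewrite (eq_bigl xpredT) => [|d]; last by rewrite enum_rankK eqxx.
rewrite (eq_bigr (fun d : T => (d.1 == i)%:R)) => [|d _]; last by rewrite !mxE enum_rankK mul1r.
rewrite -(pair_big xpredT xpredT (fun a (k : 'I_4) => (a == i)%:R)) /=.
rewrite big1 // => a _; rewrite sumr_const card_ord.
by case: (a == i); apply: val_inj.
Qed.

(** The colouring is a function x constant on faces with difference 1 along every
    edge.  The image of the face functions under [edge_diff] is contained in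
    the space of edge functions whose sum around each vertex vanishes.  With n
    vertices, k components and F faces, the former has dimension F - k and the
    latter at most 2 n - (n - k) = n + k; Euler's formula F = n + 2 k makes the two
    spaces equal, and the constant function 1 is in the larger one. *)
Lemma checkerboard : exists c : T -> bool,
  (forall d, c (turn d) = ~~ c d) /\ (forall d, c (edge d) = ~~ c d).
Proof.
set comps := n_comp map_rel T.
have rkF : (\rank (face_mx *m edge_diff) + comps = n + 2 * comps)%N.
  have planar : fcard face T = (n + 2 * comps)%N := @edge_planar D.
  rewrite -planar -rank_face_mx -(mxrank_mul_ker face_mx edge_diff); congr addn.
  apply/esym/rank_cap_edge => [x /ker_precomp xf /ker_precomp xe d|x xt /ker_precomp xe].
    by rewrite xe xf /face edge_invol.
  by apply/ker_precomp => d; rewrite xe xt.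
have rkV : (\rank (edge_diff *m vertex_mx^T) + comps = n)%N.
  rewrite -mxrank_tr trmx_mul trmxK edge_diff_tr -[RHS]rank_vertex_mx.
  rewrite -(mxrank_mul_ker vertex_mx edge_diff); congr addn.
  by apply/esym/rank_cap_edge => x; rewrite vertex_mxP.
have sub : (face_mx *m edge_diff <= edge_diff :&: kermx vertex_mx^T)%MS.
  by rewrite sub_capmx submxMl; apply/sub_kermxP; rewrite vertex_face0.
have eqV := mxrank_mul_ker edge_diff vertex_mx^T.
have rk_le := rank_edge_diff.
have {}sub : (edge_diff :&: kermx vertex_mx^T <= face_mx *m edge_diff)%MS.
  rewrite -(geq_leqif (mxrank_leqif_sup sub)).
  have count (f v k r c m : nat) : (f + c = m + 2 * c -> v + c = m ->
      v + k = r -> r <= 2 * m -> k <= f)%N by lia.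
  exact: count rkF rkV eqV rk_le.
have /submxP[y yE] : ((const_mx 1 : 'rV_N) <= face_mx *m edge_diff)%MS.
  by apply: submx_trans sub; rewrite sub_capmx ones_edge ones_vertex.
pose x := y *m face_mx.
have xf d : at_pt x d = at_pt x (face d).
  by move: d; apply/ker_precomp; rewrite submxMl.
have xe d : at_pt x d - at_pt x (edge d) = 1.
  by rewrite -edge_diffE -mulmxA -yE /at_pt mxE.
have flip (a b : F) : a - b = 1 -> (b != 0) = ~~ (a != 0).
  by case: a b => [[|[|//]] ?] [[|[|//]] ?].
exists (fun d => at_pt x d != 0); split=> d; last exact: flip (xe d).
by rewrite -(flip _ _ (xe d)) [in RHS]xf /face edge_invol.
Qed.

End Checkerboard.

(** * Circles of a resolution *)

Lemma connect_agree (T : finType) (e e' : rel T) s :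
  (forall t, connect e s t -> e t =1 e' t) -> connect e s =1 connect e' s.
Proof.
move=> ee'; have both r x : connect e s x -> connect e' s x -> path e x r || path e' x r ->
    connect e s (last x r) && connect e' s (last x r).
  elim: r x => [|y r IHr] x sx s'x /=; first by rewrite sx s'x.
  rewrite -(ee' x sx y) -andb_orr => /andP[xy]; apply: IHr.
    by apply: connect_trans sx _; apply: connect1.
  by apply: connect_trans s'x _; apply: connect1; rewrite -ee'.
move=> t; apply/idP/idP=> /connectP[r r_path ->];
  by have := both r s (connect0 _ _) (connect0 _ _); rewrite r_path ?orbT => /(_ isT)/andP[].
Qed.

Section Circles.
Variable D : diagram.
Local Notation n := (ncross D).
Local Notation T := (half_edge n).
Implicit Types (L : {set 'I_n}) (a b : 'I_n) (d : T) (s t : site D).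

Lemma smooth_invol e : involutive (@smooth n e).
Proof.
case=> a k; rewrite /smooth /=; congr (_, _); apply: val_inj.
by case: e; case: k => [[|[|[|[|]]]]].
Qed.

Lemma smooth_true_false d : smooth true d = smooth false (opposite d).
Proof.
case: d => a k; rewrite /smooth /=; congr (_, _); apply: val_inj.
by case: k => [[|[|[|[|]]]]].
Qed.

Lemma opposite_invol : involutive (@opposite n).
Proof.
case=> a k; rewrite /opposite /=; congr (_, _); apply: val_inj.
by case: k => [[|[|[|[|]]]]].
Qed.

Definition circ L s : {set site D} := [set t | connect (resolution_rel L) s t].

Lemma resolution_sym L : connect_sym (resolution_rel L).
Proof.
apply: sym_connect_sym => -[d|l] [d'|l'] //=.
by congr (_ || _); apply/eqP/eqP=> ->; rewrite ?edge_invol //= smooth_invol.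
Qed.

Lemma mem_circ L s t : (t \in circ L s) = connect (resolution_rel L) s t.
Proof. by rewrite inE. Qed.

Lemma circ_self L s : s \in circ L s.
Proof. by rewrite mem_circ connect0. Qed.

Lemma eq_circ L s t : (circ L s == circ L t) = (t \in circ L s).
Proof.
apply/eqP/idP=> [->|]; first exact: circ_self.
rewrite mem_circ => st; apply/setP=> u; rewrite !mem_circ.
exact: (same_connect (@resolution_sym L)).
Qed.

Lemma circ_eq L s t : t \in circ L s -> circ L t = circ L s.
Proof. by rewrite -eq_circ => /eqP. Qed.

Lemma circlesP L (C : {set site D}) : reflect (exists s, C = circ L s) (C \in circles L).
Proof. by apply: (iffP imsetP) => [[s _ ->]|[s ->]]; exists s. Qed.

Lemma circ_in L s : circ L s \in circles L.
Proof. by apply/circlesP; exists s. Qed.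

Lemma circles_mem L C s : C \in circles L -> s \in C -> C = circ L s.
Proof. by case/circlesP=> t -> /circ_eq. Qed.

(** ** The two arcs of a crossing *)

(** A checkerboard colouring of the half-edges; both smoothings also join
    half-edges of different colours. *)
Variable c : T -> bool.
Hypothesis c_turn : forall d, c (turn d) = ~~ c d.
Hypothesis c_edge : forall d, c (edge d) = ~~ c d.

Lemma c_smooth e d : c (smooth e d) = ~~ c d.
Proof.
have : smooth e d = turn d \/ turn (smooth e d) = d.
  case: d => a k; rewrite /smooth /turn /=; case: ifP => _; [right|left] => //.
  by rewrite subrK.
by case=> [->|/(congr1 c)]; rewrite c_turn // => <-; rewrite negbK.
Qed.

(** The two half-edges of colour true at the crossing a, which are opposite and so
    lie on different arcs of either smoothing. *)
Definition arc1 a : T := (a, if c (a, 0) then 0 else 1).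
Definition arc2 a : T := opposite (arc1 a).

Lemma c_opposite d : c (opposite d) = c d.
Proof.
have -> : opposite d = turn (turn d) by rewrite /opposite /turn /= -addrA.
by rewrite !c_turn negbK.
Qed.

Lemma c_arc1 a : c (arc1 a).
Proof.
rewrite /arc1; case c0: (c (a, 0)) => //.
by have := c_turn (a, 0); rewrite c0 /turn /= add0r.
Qed.

Lemma c_arc2 a : c (arc2 a).
Proof. by rewrite c_opposite c_arc1. Qed.

Lemma arc1_neq2 a : arc1 a != arc2 a.
Proof. by rewrite /arc2 /arc1 /opposite; case: ifP => _; apply/eqP => -[]. Qed.

Lemma arc_cases d : c d -> d = arc1 d.1 \/ d = arc2 d.1.
Proof.
case: d => a k /=; rewrite /arc2 /arc1 /opposite /=.
have c1 : c (a, 1) = ~~ c (a, 0) by rewrite -c_turn /turn /= add0r.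
have c2 : c (a, 1 + 1) = c (a, 0) by have := c_turn (a, 1); rewrite c1 negbK.
have c3 : c (a, 1 + 1 + 1) = ~~ c (a, 0) by have := c_turn (a, 1 + 1); rewrite c2.
have : [\/ k = 0, k = 1, k = 1 + 1 | k = 1 + 1 + 1].
  case: k => [[|[|[|[|//]]]] k4];
  by [apply: Or41; apply: val_inj | apply: Or42; apply: val_inj
     |apply: Or43; apply: val_inj | apply: Or44; apply: val_inj].
by case=> ->; rewrite ?c1 ?c2 ?c3; case: (c (a, 0)) => // _;
  [left | left | right | right]; congr (_, _); apply: val_inj.
Qed.

Lemma opposite_arc2 a : opposite (arc2 a) = arc1 a.
Proof. exact: opposite_invol. Qed.

Local Notation pt1 a := (inl (arc1 a) : site D).
Local Notation pt2 a := (inl (arc2 a) : site D).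

Definition agree_off a L L' := forall b, b != a -> (b \in L) = (b \in L').

Lemma agree_offC a L L' : agree_off a L L' -> agree_off a L' L.
Proof. by move=> LL' b ba; rewrite LL'. Qed.

Lemma agree_off_add a L : agree_off a L (a |: L).
Proof. by move=> b /negPf ba; rewrite in_setU1 ba. Qed.

(** Each half-edge at a lies on the circle of one of the two arcs, so the
    hypotheses say that the circle of s meets no half-edge at a. *)
Lemma circ_untouched a L L' s : agree_off a L L' ->
  pt1 a \notin circ L s -> pt2 a \notin circ L s -> circ L' s = circ L s.
Proof.
move=> LL' s1 s2; apply/setP=> t; rewrite !mem_circ; apply/esym; move: t.
apply: connect_agree => -[d|l] sd [d'|l'] //=.
rewrite LL' //; apply/eqP=> da.
have off d0 : connect (resolution_rel L) s (inl d0) -> d0.1 = a -> c d0 -> False.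
  move=> sd0 d0a /arc_cases; rewrite d0a => -[d0E|d0E];
  by [move: s1; rewrite mem_circ -d0E sd0 | move: s2; rewrite mem_circ -d0E sd0].
have [cd|/negPf cd] := boolP (c d); first exact: off sd da cd.
apply: (off (smooth (d.1 \in L) d)); rewrite ?c_smooth ?cd //.
by apply: connect_trans sd _; apply: connect1; rewrite /= eqxx orbT.
Qed.

(** ** Surgery at a crossing *)

(** Crossing the smoothing and then the edge keeps the colour true, so it
    moves each half-edge of colour true along its circle to the next one; the
    others are fixed. *)
Definition strand_fun L d := if c d then edge (smooth (d.1 \in L) d) else d.

Lemma strand_inj L : injective (strand_fun L).
Proof.
have cs d : c (strand_fun L d) = c d.
  by rewrite /strand_fun; case: ifP => // cd; rewrite c_edge c_smooth cd.
move=> d d' dd'; have := cs d; rewrite dd' cs; move: dd'; rewrite /strand_fun.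
case: ifP => _ + cE; rewrite cE //= => /(@edge_inj D) dd'.
have : (smooth (d.1 \in L) d).1 = (smooth (d'.1 \in L) d').1 by rewrite dd'.
by rewrite /= => d1; move: dd'; rewrite d1 => /(inv_inj (smooth_invol _)).
Qed.

Definition strand L : {perm T} := perm (@strand_inj L).

Lemma strandE L d : c d -> strand L d = edge (smooth (d.1 \in L) d).
Proof. by move=> cd; rewrite permE /strand_fun cd. Qed.

(** Every half-edge of colour false is joined by the smoothing to one of colour
    true on the same circle, its base, and the orbit of the base is constant along
    the circle. *)
Lemma porbit_circ L d d' : c d -> c d' ->
  (d \in porbit (strand L) d') = (inl d' \in circ L (inl d)).
Proof.
move=> cd cd'; rewrite mem_circ; apply/idP/idP.
  rewrite porbit_sym => /porbitP[k ->].
  suff: c ((strand L ^+ k)%g d) && connect (resolution_rel L) (inl d) (inl ((strand L ^+ k)%g d)).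
    by case/andP.
  elim: k => [|k /andP[ck IHk]]; first by rewrite expg0 perm1 cd connect0.
  rewrite expgSr permM strandE // c_edge c_smooth ck /=.
  apply: connect_trans IHk _; set d0 := (strand L ^+ k)%g d.
  apply: (connect_trans (y := inl (smooth (d0.1 \in L) d0))); apply: connect1.
    by rewrite /= eqxx orbT.
  by rewrite /= eqxx.
pose base d0 := if c d0 then d0 else smooth (d0.1 \in L) d0.
pose orb (s : site D) := if s is inl d0 then porbit (strand L) (base d0) else set0.
have c_base d0 : c (base d0) by rewrite /base; case: ifP => // cd0; rewrite c_smooth cd0.
have orb_step d0 : porbit (strand L) (strand L d0) = porbit (strand L) d0.
  by have := porbit_perm (strand L) 1 d0; rewrite expg1.
have orbE s t : resolution_rel L s t -> orb s = orb t.
  case: s t => [d0|l] [d1|l'] //= /orP[]/eqP->; rewrite /base ?c_edge ?c_smooth.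
    case: ifP => cd0 /=; last first.
      by rewrite -orb_step strandE ?c_smooth ?cd0 //= smooth_invol.
    by rewrite -[in RHS]orb_step strandE ?c_smooth ?c_edge ?cd0 //= smooth_invol edge_invol.
  by case: ifP => cd0 //=; rewrite smooth_invol.
have orb_conn s t : connect (resolution_rel L) s t -> orb s = orb t.
  case/connectP=> r; elim: r s => [|u r IHr] s /=; first by move=> _ ->.
  by case/andP=> /orbE-> r_path tE; apply: IHr.
by move/orb_conn; rewrite /= /base cd cd' => /eqP; rewrite eq_porbit_mem.
Qed.

Lemma strand_surgery a L : a \notin L -> strand (a |: L) = (tperm (arc1 a) (arc2 a) * strand L)%g.
Proof.
move=> aL; apply/permP=> d; rewrite permM.
have [cd|ncd] := boolP (c d); last first.
  have ne e : c e -> e != d by apply: contraTneq => ->.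
  by rewrite tpermD ?ne ?c_arc1 ?c_arc2 // !permE /strand_fun (negPf ncd).
have [da|da] := eqVneq d.1 a; last first.
  have ne e : e.1 = a -> e != d by move=> ea; apply: contraNneq da => <-; rewrite ea.
  by rewrite tpermD ?ne // !strandE // in_setU1 (negPf da).
have [] := arc_cases cd; rewrite da => ->.
  by rewrite tpermL !strandE ?c_arc1 ?c_arc2 //= in_setU1 eqxx (negPf aL) smooth_true_false.
rewrite tpermR !strandE ?c_arc1 ?c_arc2 //= in_setU1 eqxx (negPf aL) smooth_true_false.
by rewrite opposite_arc2.
Qed.

(** For a not in L, the surgery at a splits a circle when this holds, and merges
    two circles otherwise. *)
Definition joined L a : bool := pt2 a \in circ L (pt1 a).

Local Notation strands L := #|porbits (strand L)|.

(** Multiplying a permutation by a transposition changes its number of cycles by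
    one, up or down according to whether the two points are in the same
    cycle. *)
Lemma strands_surgery a L : a \notin L ->
  (strands (a |: L) + 2 * ~~ joined L a = strands L + 1 /\
   strands L + 2 * ~~ joined (a |: L) a = strands (a |: L) + 1)%N.
Proof.
move=> aL; have surg := strand_surgery aL.
have count := fun L' => porbits_mul_tperm (strand L') (arc1 a) (arc2 a).
have orbit L' := porbit_circ L' (c_arc1 a) (c_arc2 a).
split; first by have := count L; rewrite /= -surg orbit arc1_neq2 -mul2n.
have := count (a |: L); rewrite /= orbit arc1_neq2 -mul2n.
by rewrite {1}surg mulgA tperm2 mul1g.
Qed.

Lemma joined_flip a L : a \notin L -> joined (a |: L) a = ~~ joined L a.
Proof. by move/strands_surgery; case: (joined L a); case: (joined _ a) => /= -[]; lia. Qed.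

(** Both sides count the splits along one of the two paths from L to
    L + a + b; the paths have the same number of splits since each surgery
    changes the number of circles by one. *)
Lemma joined_exchange a b L : a \notin L -> b \notin L -> a != b ->
  (joined L a + joined (a |: L) b = joined L b + joined (b |: L) a)%N.
Proof.
move=> aL bL ab; have [aE _] := strands_surgery aL; have [bE _] := strands_surgery bL.
have [|abE _] := @strands_surgery b (a |: L); first by rewrite in_setU1 eq_sym (negPf ab).
have [|baE _] := @strands_surgery a (b |: L); first by rewrite in_setU1 (negPf ab).
rewrite setUCA in baE; move: aE bE abE baE.
by case: (joined L a); case: (joined L b); case: (joined (a |: L) b);
   case: (joined (b |: L) a) => /=; lia.
Qed.

Lemma circ_touch a L s : s \in circ L (pt1 a) \/ s \in circ L (pt2 a) \/
  (pt1 a \notin circ L s /\ pt2 a \notin circ L s).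
Proof.
rewrite -!eq_circ eq_sym [_ == circ L s]eq_sym.
by do 2!case: eqP => _; auto.
Qed.

Lemma circles_surgery a L L' : agree_off a L L' -> joined L a -> ~~ joined L' a ->
  circles L :\: circles L' = [set circ L (pt1 a)] /\
  circles L' :\: circles L = [set circ L' (pt1 a); circ L' (pt2 a)].
Proof.
move=> LL' jL jL'; split; apply/setP=> C; rewrite !inE; apply/andP/idP.
- case=> CL' /circlesP[s CE]; rewrite CE eq_sym eq_circ.
  have [|[|[s1 s2]]] := circ_touch a L s; rewrite ?mem_circ ?(resolution_sym L (pt1 a)) //.
    by rewrite -!mem_circ -!eq_circ (circ_eq jL) eq_sym => /eqP->.
  by move: CL'; rewrite CE -(circ_untouched LL' s1 s2) circ_in.
- move/eqP->; rewrite circ_in; split=> //; apply: contra jL' => in_L'.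
  by rewrite /joined -(circles_mem in_L' (circ_self _ _)).
- case=> CL /circlesP[s CE]; rewrite CE ![circ L' s == _]eq_sym !eq_circ.
  have [->|[->|[s1 s2]]] := circ_touch a L' s; rewrite ?orbT //.
  by move: CL; rewrite CE -(circ_untouched (agree_offC LL') s1 s2) circ_in.
have other s : s = pt1 a \/ s = pt2 a -> circ L' s \notin circles L.
  move=> sE; apply: contra jL' => in_L.
  have circL : circ L' s = circ L (pt1 a).
    rewrite (circles_mem in_L (circ_self _ _)); case: sE => -> //.
    exact: circ_eq.
  have s1 : pt1 a \in circ L' s by rewrite circL circ_self.
  by rewrite /joined (circ_eq s1) circL.
by case/orP=> /eqP->; split; rewrite ?circ_in ?other //; [left | right].
Qed.

End Circles.

(** * The square of the differential *)

Lemma enum_pair (T : finType) (x y : T) : x != y ->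
  enum [set x; y] = [:: x; y] \/ enum [set x; y] = [:: y; x].
Proof.
move=> xy; have := cards2 x y; rewrite xy cardE.
have : uniq (enum [set x; y]) by apply: enum_uniq.
have := mem_enum [set x; y]; case: (enum _) => [|u [|v []]] //= mem.
have := mem u; have := mem v; have := mem x; have := mem y.
rewrite !inE !eqxx ?orbT /= => + + /esym + /esym.
rewrite [y == u]eq_sym [y == v]eq_sym [x == u]eq_sym [x == v]eq_sym.
by do 4![case: eqVneq => [?|_] //=]; subst; rewrite ?eqxx // in xy *; auto.
Qed.

Lemma m_coefC x y z : m_coef x y z = m_coef y x z.
Proof. by case: x; case: y. Qed.

Lemma Delta_coefC x y z : Delta_coef x y z = Delta_coef x z y.
Proof. by case: x; case: y; case: z. Qed.

Section Square.
Variable D : diagram.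
Local Notation n := (ncross D).
Implicit Types (L : {set 'I_n}) (a b : 'I_n) (s t : site D) (g h : gen D).
Implicit Types (v w : chain D) (X Y I : {set {set site D}}) (C : {set site D}).

Definition gen0 : gen D := Sub (set0, set0) (sub0set _).

(** The generator (L, X), meant for X a set of circles of L. *)
Definition mkgen L X : gen D := insubd gen0 (L, X).

Lemma gset_mk L X : X \subset circles L -> gset (mkgen L X) = L.
Proof. by move=> XL; rewrite /gset insubdK. Qed.

Lemma gX_mk L X : X \subset circles L -> gX (mkgen L X) = X.
Proof. by move=> XL; rewrite /gX insubdK. Qed.

Lemma gX_sub g : gX g \subset circles (gset g).
Proof. exact: (valP g). Qed.

Lemma gen_eq g h : (g == h) = (gset g == gset h) && (gX g == gX h).
Proof. by rewrite -val_eqE; case: g h => [[L X] gP] [[L' X'] hP]. Qed.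

Definition addX s g := mkgen (gset g) (circ (gset g) s |: gX g).
Definition remX s g := mkgen (gset g) (gX g :\ circ (gset g) s).

Lemma addX_sub s g : circ (gset g) s |: gX g \subset circles (gset g).
Proof. by rewrite subUset sub1set circ_in gX_sub. Qed.

Lemma remX_sub s g : gX g :\ circ (gset g) s \subset circles (gset g).
Proof. by apply: subset_trans (gX_sub g); apply: subsetDl. Qed.

Lemma gset_addX s g : gset (addX s g) = gset g.
Proof. by rewrite gset_mk ?addX_sub. Qed.
Lemma gX_addX s g : gX (addX s g) = circ (gset g) s |: gX g.
Proof. by rewrite gX_mk ?addX_sub. Qed.
Lemma gset_remX s g : gset (remX s g) = gset g.
Proof. by rewrite gset_mk ?remX_sub. Qed.
Lemma gX_remX s g : gX (remX s g) = gX g :\ circ (gset g) s.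
Proof. by rewrite gX_mk ?remX_sub. Qed.

Definition has_X s g := circ (gset g) s \in gX g.

Lemma addXK s g : (remX s (addX s g) == g) = ~~ has_X s g.
Proof.
rewrite gen_eq gset_remX gX_remX !gset_addX gX_addX eqxx /= /has_X.
apply/eqP/idP => [<-|gs]; first by rewrite !inE eqxx.
by rewrite setU1K.
Qed.

Lemma remXK s g : has_X s g -> addX s (remX s g) = g.
Proof.
move=> gs; apply/eqP; rewrite gen_eq gset_addX gX_addX !gset_remX gX_remX eqxx /=.
by rewrite setD1K.
Qed.

(** Multiplication by X at the circle through s: the coefficient of h in the
    product comes from the generator obtained from h by putting 1 at that circle. *)
Definition mulX s v : chain D := [ffun h => if has_X s h then v (remX s h) else 0].

Lemma mulXE s v h : mulX s v h = if has_X s h then v (remX s h) else 0.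
Proof. by rewrite ffunE. Qed.

Lemma mulX_linear s : linear (mulX s).
Proof.
move=> k u v; apply/ffunP=> h; rewrite !ffunE; case: ifP => _; rewrite ?ffunE //.
by rewrite scaler0 addr0.
Qed.
HB.instance Definition _ s :=
  GRing.isLinear.Build Zc (chain D) (chain D) _ (mulX s) (mulX_linear s).

Definition xi_entry a g h : Zc :=
  if (a \notin gset g) && (gset h == a |: gset g) then xi_coef g h else 0.

(** The map xi_a on all vertices L of the cube with a not in L, and 0 on the
    others. *)
Definition xi a v : chain D := [ffun h => \sum_g v g * xi_entry a g h].

Lemma xi_linear a : linear (xi a).
Proof.
move=> k u v; apply/ffunP=> h; rewrite !ffunE scaler_sumr -big_split /=.
by apply: eq_bigr => g _; rewrite !ffunE mulrDl scalerAl.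
Qed.
HB.instance Definition _ a :=
  GRing.isLinear.Build Zc (chain D) (chain D) _ (xi a) (xi_linear a).

Definition delta g : chain D := [ffun h => (h == g)%:R].
(** The unit of V_D(L). *)
Definition vac L : chain D := delta (mkgen L set0).

Lemma gset_vac L : gset (mkgen L set0) = L.
Proof. by rewrite gset_mk ?sub0set. Qed.
Lemma gX_vac L : gX (mkgen L set0) = set0.
Proof. by rewrite gX_mk ?sub0set. Qed.

Lemma chain_delta v : v = \sum_g v g *: delta g.
Proof.
apply/ffunP=> h; rewrite sum_ffunE (bigD1 h) //= big1 ?addr0 => [|g /negPf gh].
  by rewrite !ffunE eqxx [_ *: _]mulr1.
by rewrite !ffunE eq_sym gh scaler0.
Qed.

Lemma mulX_delta s g : has_X s g -> delta g = mulX s (delta (remX s g)).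
Proof.
move=> gs; apply/ffunP=> h; rewrite !ffunE.
have [->|hg] := eqVneq h g; first by rewrite gs eqxx.
case: ifP => // hs; case: eqVneq => // e.
by case/eqP: hg; rewrite -(remXK hs) e remXK.
Qed.

(** The unit generates V_D(L) under the operators [mulX]. *)
Lemma delta_ind L (f1 f2 : chain D -> chain D) :
  (forall s v, f1 (mulX s v) = mulX s (f1 v)) ->
  (forall s v, f2 (mulX s v) = mulX s (f2 v)) ->
  f1 (vac L) = f2 (vac L) -> forall g, gset g = L -> f1 (delta g) = f2 (delta g).
Proof.
move=> f1X f2X f12 g; move: {2}#|_| (leqnn #|gX g|) => k.
elim: k g => [|k IHk] g gk gL.
  suff -> : g = mkgen L set0 by [].
  by apply/eqP; rewrite gen_eq gset_vac gX_vac gL -cards_eq0 -leqn0 gk eqxx.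
have [X0|[C XC]] := set_0Vmem (gX g); first by apply: IHk => //; rewrite X0 cards0.
have /circlesP[s CE] := subsetP (gX_sub g) _ XC.
have gs : has_X s g by rewrite /has_X -CE.
rewrite (mulX_delta gs) f1X f2X IHk // ?gset_remX // gX_remX.
by move: gk; rewrite (cardsD1 C) XC CE.
Qed.

Lemma mulXC s t v : mulX s (mulX t v) = mulX t (mulX s v).
Proof.
apply/ffunP=> h; rewrite !ffunE /has_X !gset_remX !gX_remX !in_setD1.
have [->|st] := eqVneq (circ (gset h) t) (circ (gset h) s).
  rewrite /=; exact: erefl.
rewrite /=; case: (circ (gset h) s \in gX h); case: (circ (gset h) t \in gX h);
  [|exact: erefl..].
congr (v _); apply/eqP; rewrite gen_eq !gset_remX eqxx !gX_remX !gset_remX /=.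
by rewrite !setDDl setUC.
Qed.

Definition supported L v := forall g, gset g != L -> v g = 0.

Lemma supported_delta g : supported (gset g) (delta g).
Proof. by move=> h; rewrite ffunE; case: (eqVneq h g) => // ->; rewrite eqxx. Qed.

Lemma supported_vac L : supported L (vac L).
Proof. by have := @supported_delta (mkgen L set0); rewrite gset_vac. Qed.

Lemma supported_mulX L s v : supported L v -> supported L (mulX s v).
Proof. by move=> Lv g gL; rewrite ffunE; case: ifP => // _; rewrite Lv ?gset_remX. Qed.

Lemma supported_xi L a v : supported L v -> supported (a |: L) (xi a v).
Proof.
move=> Lv h hL; rewrite ffunE big1 // => g _.
have [gL|/Lv->] := eqVneq (gset g) L; last by rewrite mul0r.
by rewrite /xi_entry gL (negPf hL) andbF mulr0.
Qed.

Lemma mulX_congr L s t v : supported L v -> circ L s = circ L t -> mulX s v = mulX t v.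
Proof.
move=> Lv st; apply/ffunP=> h; have [hL|hL] := eqVneq (gset h) L.
  by rewrite !ffunE /has_X /remX hL st.
by rewrite !(supported_mulX _ Lv hL).
Qed.

(** The coefficient of an edge map tests whether two generators agree on the set
    I of circles common to both ends.  Putting X at such a circle on one side
    amounts to removing it on the other side; circles outside I do not matter. *)
Lemma trace_eq C X Y I : C \in I ->
  (C \notin X) && ((C |: X) :&: I == Y :&: I) = (C \in Y) && (X :&: I == (Y :\ C) :&: I).
Proof.
move=> CI; apply/andP/andP => -[CX /eqP /setP E]; split.
- by have := E C; rewrite !inE eqxx CI /= !andbT.
- apply/eqP/setP=> B; have := E B; rewrite !inE.
  by have [->|] := eqVneq B C; rewrite ?(negPf CX).
- by have := E C; rewrite !inE eqxx CI /= andbT => ->.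
- apply/eqP/setP=> B; have := E B; rewrite !inE.
  by have [->|] := eqVneq B C; rewrite ?CX ?CI.
Qed.

Lemma trace_add C X I : C \notin I -> (C |: X) :&: I = X :&: I.
Proof.
move=> CI; apply/setP=> B; rewrite !inE.
by have [->|] := eqVneq B C; rewrite ?(negPf CI) ?andbF.
Qed.

Lemma trace_rem C X I : C \notin I -> (X :\ C) :&: I = X :&: I.
Proof.
move=> CI; apply/setP=> B; rewrite !inE.
by have [->|] := eqVneq B C; rewrite ?(negPf CI) ?andbF.
Qed.

Variable c : half_edge n -> bool.
Hypothesis c_turn : forall d, c (turn d) = ~~ c d.
Hypothesis c_edge : forall d, c (edge d) = ~~ c d.

Local Notation pt1 a := (inl (arc1 c a) : site D).
Local Notation pt2 a := (inl (arc2 c a) : site D).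
Local Notation joined L a := (joined c L a).

Lemma joinedE L a : joined L a = (circ L (pt1 a) == circ L (pt2 a)).
Proof. by rewrite eq_circ. Qed.

Lemma touched_circles a L : a \notin L ->
  circles L :\: circles (a |: L) = [set circ L (pt1 a); circ L (pt2 a)] /\
  circles (a |: L) :\: circles L = [set circ (a |: L) (pt1 a); circ (a |: L) (pt2 a)].
Proof.
move=> aL; have flip := joined_flip c_turn c_edge aL.
have off := @agree_off_add D a L; case jL: (joined L a) in flip.
  have [|-> ->] := circles_surgery c_turn off jL; first by rewrite flip.
  by move: jL; rewrite joinedE => /eqP<-; rewrite setUid.
have [|-> ->] := circles_surgery c_turn (agree_offC off) flip; first by rewrite jL.
by move: flip; rewrite joinedE => /eqP<-; rewrite setUid.
Qed.

Definition untouched a L := circles L :&: circles (a |: L).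

Lemma touchedN a L s : a \notin L -> s = pt1 a \/ s = pt2 a ->
  circ L s \notin untouched a L /\ circ (a |: L) s \notin untouched a L.
Proof.
move=> aL sE; have [E E'] := touched_circles aL.
have : circ L s \in circles L :\: circles (a |: L).
  by rewrite E !inE; case: sE => ->; rewrite eqxx ?orbT.
have : circ (a |: L) s \in circles (a |: L) :\: circles L.
  by rewrite E' !inE; case: sE => ->; rewrite eqxx ?orbT.
rewrite !inE => /andP[/negPf s1 _] /andP[/negPf s2 _].
by rewrite s1 s2 andbF.
Qed.

Definition same_trace a g h :=
  gX g :&: untouched a (gset g) == gX h :&: untouched a (gset g).

(** A split starts from a single circle at the crossing, where y = x, and a merge
    ends in a single one, where y' = x'. *)
Definition surgery_coef (split x y x' y' : bool) : Zc :=
  if split then Delta_coef x x' y' else m_coef x y x'.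

Lemma xi_coefE a g h : a \notin gset g -> gset h = a |: gset g ->
  xi_coef g h = if same_trace a g h then
    surgery_coef (joined (gset g) a)
      (circ (gset g) (pt1 a) \in gX g) (circ (gset g) (pt2 a) \in gX g)
      (circ (gset h) (pt1 a) \in gX h) (circ (gset h) (pt2 a) \in gX h) else 0.
Proof.
move=> aL hE; rewrite /xi_coef /same_trace /untouched hE; case: ifP => // _.
have [-> ->] := touched_circles aL; have := joined_flip c_turn c_edge aL.
rewrite /surgery_coef; case: ifP => jL; rewrite joinedE => jL'.
  move: jL; rewrite joinedE => /eqP <-; rewrite setUid enum_set1.
  have /enum_pair[->|->] // : circ (a |: gset g) (pt1 a) != circ (a |: gset g) (pt2 a).
    by rewrite jL'.
  exact: Delta_coefC.
rewrite -(eqP jL') setUid enum_set1.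
have /enum_pair[->|->] // : circ (gset g) (pt1 a) != circ (gset g) (pt2 a).
  by rewrite -joinedE jL.
exact: m_coefC.
Qed.

Lemma circ_touch_both a L s : a \notin L ->
  (circ L s = circ (a |: L) s /\ circ L s \in untouched a L) \/
  ((circ L s = circ L (pt1 a) \/ circ L s = circ L (pt2 a)) /\
   (circ (a |: L) s = circ (a |: L) (pt1 a) \/ circ (a |: L) s = circ (a |: L) (pt2 a))).
Proof.
move=> aL; have off := @agree_off_add D a L.
have [/circ_eq sL|[/circ_eq sL|[s1 s2]]] := circ_touch c a L s; last first.
  have E := circ_untouched c_turn off s1 s2.
  by left; rewrite E inE circ_in -E circ_in.
all: right; split; first by auto.
all: have [/circ_eq|[/circ_eq|[s1 s2]]] := circ_touch c a (a |: L) s; auto.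
all: have E := circ_untouched c_turn (agree_offC off) s1 s2.
  by have [+ _] := @touchedN a L (pt2 a) aL (or_intror erefl); rewrite -sL inE circ_in {1}E circ_in.
by have [+ _] := @touchedN a L (pt1 a) aL (or_introl erefl); rewrite -sL inE circ_in {1}E circ_in.
Qed.

(** If the circle of s is common to both ends this is [trace_eq]; otherwise it is
    one of the circles at the crossing a on both sides, and what remains is that m
    and Delta are linear over A, read on structure constants. *)
Lemma xi_entry_mulX a s g h :
  (if has_X s h then xi_entry a g (remX s h) else 0) =
  (if has_X s g then 0 else xi_entry a (addX s g) h).
Proof.
rewrite /xi_entry gset_remX gset_addX.
case: (boolP ((a \notin _) && _)) => [/andP[aL /eqP hE]|_]; last by rewrite !if_same.
rewrite !(xi_coefE (a := a)) ?gset_addX ?gset_remX //.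
rewrite /has_X /same_trace !gset_addX !gX_addX !gX_remX.
set L := gset g in aL hE *; rewrite !hE; have tN := touchedN aL.
have [p1 p1'] := tN (pt1 a) (or_introl erefl); have [p2 p2'] := tN (pt2 a) (or_intror erefl).
have [[<- CI]|[sL sL']] := circ_touch_both s aL.
  have ne B : B \notin untouched a L -> (B == circ L s) = false.
    by apply: contraNF => /eqP->.
  rewrite !in_setU1 !in_setD1 !ne //=.
  have := trace_eq (gX g) (gX h) CI.
  by case: (circ L s \in gX g); case: (circ L s \in gX h) => //= E;
    rewrite ?E // -E.
have CI : circ L s \notin untouched a L by case: sL => ->.
have CI' : circ (a |: L) s \notin untouched a L by case: sL' => ->.
rewrite trace_add // trace_rem //; case: (gX g :&: _ == gX h :&: _); last by rewrite !if_same.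
rewrite !in_setU1 !in_setD1; have := joined_flip c_turn c_edge aL.
rewrite /surgery_coef; case jL: (joined L a); rewrite joinedE => jL'.
  move: jL; rewrite joinedE => /eqP jL; rewrite -jL in sL.
  have -> : circ L s = circ L (pt1 a) by case: sL.
  have jL2 : (circ (a |: L) (pt2 a) == circ (a |: L) (pt1 a)) = false by rewrite eq_sym jL'.
  rewrite eqxx /=; case: sL' => ->; rewrite eqxx ?jL' ?jL2 /=;
  by case: (circ L (pt1 a) \in gX g);
     case: (circ (a |: L) (pt1 a) \in gX h); case: (circ (a |: L) (pt2 a) \in gX h).
move/eqP in jL'; rewrite -jL' in sL'.
have -> : circ (a |: L) s = circ (a |: L) (pt1 a) by case: sL'.
rewrite joinedE in jL.
have jL2 : (circ L (pt2 a) == circ L (pt1 a)) = false by rewrite eq_sym jL.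
rewrite eqxx /=; case: sL => ->; rewrite eqxx ?jL ?jL2 /=;
by case: (circ L (pt1 a) \in gX g); case: (circ L (pt2 a) \in gX g);
   case: (circ (a |: L) (pt1 a) \in gX h).
Qed.

Lemma xi_mulX a s v : xi a (mulX s v) = mulX s (xi a v).
Proof.
apply/ffunP=> h; rewrite !ffunE.
transitivity (\sum_g v g * (if has_X s g then 0 else xi_entry a (addX s g) h)); last first.
  under eq_bigr do rewrite -xi_entry_mulX.
  by case: ifP => _ //; rewrite big1 // => g _; rewrite mulr0.
rewrite (bigID (has_X s)) /= [X in _ + X]big1 ?addr0; last first.
  by move=> g /negPf gs; rewrite ffunE gs mul0r.
rewrite [RHS](bigID (has_X s)) /= [X in _ = X + _]big1 ?add0r; last first.
  by move=> g ->; rewrite mulr0.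
rewrite (reindex_onto (addX s) (remX s)) /=; last by move=> g /remXK.
have has_add g : has_X s (addX s g) by rewrite /has_X gset_addX gX_addX setU11.
rewrite (eq_bigl (fun g => ~~ has_X s g)) => [|g]; last by rewrite has_add addXK.
apply: eq_bigr => g gs; rewrite ffunE has_add (negPf gs).
by congr (v _ * _); apply/eqP; rewrite addXK.
Qed.

(** Multiplication by Delta(1) = X_s + X_t + c X_s X_t, with s and t on the two arcs
    at a. *)
Definition split_mul a v : chain D :=
  mulX (pt1 a) v + mulX (pt2 a) v + cvar *: mulX (pt1 a) (mulX (pt2 a) v).

Lemma split_mulE a v h : split_mul a v h =
  (mulX (pt1 a) v h : Zc) + mulX (pt2 a) v h + cvar * mulX (pt1 a) (mulX (pt2 a) v) h.
Proof.
rewrite /split_mul; move: (mulX _ v) (mulX _ v) (mulX _ (mulX _ v)) => u1 u2 u3.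
by rewrite !ffunE.
Qed.

Lemma split_mul_linear a : linear (split_mul a).
Proof.
move=> k u v; rewrite /split_mul !linearP /= !scalerDr.
have sum6 (x x' y y' z z' : chain D) :
    x + x' + (y + y') + (z + z') = x + y + z + (x' + y' + z').
  by rewrite (addrACA x x' y y'); apply: addrACA.
exact: sum6.
Qed.
HB.instance Definition _ a :=
  GRing.isLinear.Build Zc (chain D) (chain D) _ (split_mul a) (split_mul_linear a).

Lemma split_mulX (f : {linear chain D -> chain D}) a v :
  (forall s w, f (mulX s w) = mulX s (f w)) -> f (split_mul a v) = split_mul a (f v).
Proof. by move=> fX; rewrite /split_mul !linearD linearZ /= !fX. Qed.

Definition surgery_mul (split : bool) a v := if split then split_mul a v else v.

Lemma xi_surgery_mul e a b v : xi b (surgery_mul e a v) = surgery_mul e a (xi b v).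
Proof. by case: e => //; apply: (split_mulX (f := xi b)) => s w; apply: xi_mulX. Qed.

Lemma supportedD L v w : supported L v -> supported L w -> supported L (v + w).
Proof. by move=> Lv Lw g gL; rewrite ffunE Lv // Lw // addr0. Qed.

Lemma supportedZ L (k : Zc) v : supported L v -> supported L (k *: v).
Proof. by move=> Lv g gL; rewrite ffunE Lv // scaler0. Qed.

Lemma supported_split L a v : supported L v -> supported L (split_mul a v).
Proof. by move=> Lv; do ?apply: supportedD; do ?apply: supportedZ; do ?apply: supported_mulX. Qed.

Lemma split_mul_congr L a b v : supported L v ->
  (circ L (pt1 a) = circ L (pt1 b) /\ circ L (pt2 a) = circ L (pt2 b)) \/
  (circ L (pt1 a) = circ L (pt2 b) /\ circ L (pt2 a) = circ L (pt1 b)) ->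
  split_mul a v = split_mul b v.
Proof.
have two s t s' t' w : supported L w -> circ L s = circ L s' -> circ L t = circ L t' ->
    mulX s w + mulX t w + cvar *: mulX s (mulX t w) =
    mulX s' w + mulX t' w + cvar *: mulX s' (mulX t' w).
  move=> Lw E1 E2; rewrite (mulX_congr (supported_mulX _ Lw) E1).
  by rewrite (mulX_congr Lw E1) (mulX_congr Lw E2).
move=> Lv [] [E1 E2]; rewrite /split_mul (two _ _ _ _ _ Lv E1 E2); first exact: erefl.
by congr (_ + _ *: _); [apply: addrC | apply: mulXC].
Qed.

Lemma split_mulC a b v : split_mul a (split_mul b v) = split_mul b (split_mul a v).
Proof.
apply/esym/(split_mulX (f := split_mul b)) => s w.
by apply/esym/(split_mulX (f := mulX s)) => t u; apply: mulXC.
Qed.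

Lemma gX_empty L X a (Y : {set {set site D}}) : a \notin L -> X \subset circles (a |: L) ->
  Y \subset [set circ (a |: L) (pt1 a); circ (a |: L) (pt2 a)] ->
  (X :\: Y == set0) =
  [&& X :&: untouched a L == set0,
      (circ (a |: L) (pt1 a) \in X) ==> (circ (a |: L) (pt1 a) \in Y) &
      (circ (a |: L) (pt2 a) \in X) ==> (circ (a |: L) (pt2 a) \in Y)].
Proof.
move=> aL /subsetP X_sub /subsetP Y_sub; have [_ E] := touched_circles aL.
have tN := touchedN aL.
have [_ p1] := tN (pt1 a) (or_introl erefl); have [_ p2] := tN (pt2 a) (or_intror erefl).
have YI C : C \in Y -> C \notin untouched a L by move/Y_sub; rewrite in_set2 => /orP[]/eqP->.
rewrite setD_eq0; apply/idP/and3P => [/subsetP XY|[/eqP/setP I0 X1 X2]].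
  split; try by apply/implyP=> /XY.
  apply/eqP/setP=> C; rewrite in_setI in_set0; apply/negP.
  by case/andP=> /XY/YI/negPf->.
apply/subsetP=> C XC; have := X_sub C XC; have [CL CL'|CL CL'] := boolP (C \in circles L).
  by have := I0 C; rewrite !inE XC CL CL'.
have : C \in circles (a |: L) :\: circles L by rewrite inE CL CL'.
by rewrite E !inE => /orP[]/eqP CE; rewrite CE in XC *; [move: X1|move: X2]; rewrite XC.
Qed.

Lemma xi_vac a L : a \notin L -> xi a (vac L) = surgery_mul (joined L a) a (vac (a |: L)).
Proof.
move=> aL; apply/ffunP=> h; have suppL := @supported_vac (a |: L).
have [hE|hE] := eqVneq (gset h) (a |: L); last first.
  rewrite (supported_xi (@supported_vac L)) // /surgery_mul.
  by case: (joined L a); rewrite ?(supported_split _ suppL) ?suppL.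
have := joined_flip c_turn c_edge aL; rewrite joinedE => flip.
have vacE h' : gset h' = a |: L -> vac (a |: L) h' = (gX h' == set0)%:R.
  by move=> h'E; rewrite ffunE gen_eq gset_vac gX_vac h'E eqxx.
rewrite ffunE (bigD1 (mkgen L set0)) //= big1 => [|g gL]; last first.
  by rewrite ffunE (negPf gL) mul0r.
rewrite ffunE eqxx mul1r addr0 /xi_entry gset_vac aL hE eqxx /=.
rewrite (xi_coefE (a := a)) ?gset_vac // gX_vac !inE /same_trace gX_vac gset_vac set0I hE eq_sym.
have hX : gX h \subset circles (a |: L) by rewrite -hE gX_sub.
have empty := gX_empty aL hX.
rewrite /surgery_mul /surgery_coef; case: (joined L a) flip => flip.
  rewrite split_mulE !mulXE /has_X !vacE ?gset_remX // !gX_remX !gset_remX hE.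
  rewrite setDDl !empty ?sub1set ?subxx ?inE ?eqxx ?orbT //.
  rewrite flip [circ _ (pt2 a) == _]eq_sym flip.
  case: (gX h :&: _ == set0); case: (_ (pt1 a) \in gX h); case: (_ (pt2 a) \in gX h);
    by rewrite /= ?mulr1 ?mulr0 ?addr0 ?add0r.
rewrite vacE // -[gX h]setD0 empty ?sub0set // !inE !setD0 -(eqP flip).
by case: (gX h :&: _ == set0); case: (_ \in gX h).
Qed.

(** ** Commuting surgeries *)

(** If the surgery at b changes whether the arcs at a are on one circle, then both
    circles at a pass through b. *)
Lemma joined_touch a b L : a \notin L -> b \notin L -> a != b ->
  joined (b |: (a |: L)) a != joined (a |: L) a ->
  forall s, s = pt1 a \/ s = pt2 a ->
    circ (b |: (a |: L)) s = circ (b |: (a |: L)) (pt1 b) \/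
    circ (b |: (a |: L)) s = circ (b |: (a |: L)) (pt2 b).
Proof.
move=> aL bL ab jj s sE.
have [/circ_eq ->|[/circ_eq ->|[s1 s2]]] := circ_touch c b (b |: (a |: L)) s; auto.
have off := agree_offC (@agree_off_add D b (a |: L)).
have E := circ_untouched c_turn off s1 s2.
have jE K : joined K a = (pt1 a \in circ K s) && (pt2 a \in circ K s).
  rewrite joinedE -!eq_circ; case: sE => ->; rewrite eqxx ?andbT //= eq_sym //.
by case/negP: jj; rewrite !jE E.
Qed.

Lemma bool_exchange (x y x' y' : bool) : (x + y' = y + x')%N ->
  x = x' /\ y = y' \/ [/\ x = y, x' = y' & x' = ~~ x].
Proof. by case: x; case: y; case: x'; case: y' => // _; [left|right|left|left|right|left]. Qed.

Lemma neq_negb x : x != ~~ x.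
Proof. by case: x. Qed.

Lemma surgery_mulC e e' a b v :
  surgery_mul e a (surgery_mul e' b v) = surgery_mul e' b (surgery_mul e a v).
Proof.
by case: e; [case: e'; [exact: split_mulC | exact: erefl] | exact: erefl].
Qed.

(** Along one path the unit is multiplied by the factor of each crossing that
    splits.  By [joined_exchange] either each crossing splits on both paths or on
    none, and the factors are the same; or exactly one crossing splits on
    either path, a different one on each.  In that case the circles through the
    arcs at a and those through the arcs at b are the same in the last
    resolution, by [joined_touch], so the two factors act in the same way. *)
Lemma xi_vac_comm a b L : a \notin L -> b \notin L -> a != b ->
  xi b (xi a (vac L)) = xi a (xi b (vac L)).
Proof.
move=> aL bL ab.
have bLa : b \notin a |: L by rewrite in_setU1 eq_sym (negPf ab).
have aLb : a \notin b |: L by rewrite in_setU1 (negPf ab).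
have LabE : a |: (b |: L) = b |: (a |: L) by rewrite setUCA.
rewrite (xi_vac aL) (xi_vac bL) (xi_surgery_mul _ a b) (xi_surgery_mul _ b a).
rewrite (xi_vac bLa) (xi_vac aLb) LabE.
have [[<- <-]|[<- bE aE]] := bool_exchange (joined_exchange c_turn c_edge aL bL ab).
  exact: surgery_mulC.
suff E : split_mul a (vac (b |: (a |: L))) = split_mul b (vac (b |: (a |: L))).
  rewrite -bE aE /surgery_mul; case: (joined L a); [exact: E | exact/esym].
have flip_a := joined_flip c_turn c_edge aL.
have flip_a' := joined_flip c_turn c_edge aLb; rewrite LabE in flip_a'.
have flip_b' := joined_flip c_turn c_edge bLa.
have touch := @joined_touch a b L; rewrite flip_a flip_a' in touch.
have {touch}touch := touch aL bL ab; rewrite aE negbK in touch.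
have {touch}touch := touch (neq_negb (joined L a)).
rewrite -bE -flip_a' in flip_b'; rewrite !joinedE in flip_b'.
apply: (split_mul_congr (@supported_vac _)).
have E1 := touch (pt1 a) (or_introl erefl); have E2 := touch (pt2 a) (or_intror erefl).
move: flip_b'; case: E1 => ->; case: E2 => ->; rewrite ?eqxx => E.
- by left; rewrite (eqP E).
- by left.
- by right.
- by left; rewrite (eqP E).
Qed.

End Square.

Lemma alternating_sum (R : comNzRingType) (V : lmodType R) n (t : 'I_n -> 'I_n -> V) :
  (forall a b, a != b -> t a b = t b a) ->
  \sum_(a < n) \sum_(b < n | b != a) (-1) ^+ (b < a)%N *: t a b = 0.
Proof.
move=> tC; under eq_bigr => a _ do rewrite (bigID (fun b : 'I_n => b < a)%N) /=.
rewrite big_split /= addrC; apply/eqP; rewrite addr_eq0; apply/eqP.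
transitivity (\sum_(a < n) \sum_(b < n | (a < b)%N) t a b).
  apply: eq_bigr => a _; apply: eq_big => [b|b /andP[_ /negPf->]]; last by rewrite scale1r.
  by rewrite -leqNgt ltn_neqAle -val_eqE eq_sym.
rewrite -sumrN (exchange_big_dep xpredT) //=; apply: eq_bigr => b _; rewrite -sumrN.
apply: eq_big => [a|a ab]; first by rewrite -val_eqE /=; case: ltngtP.
by rewrite ab expr1 scaleN1r opprK tC // -val_eqE neq_ltn ab.
Qed.

Section DiffSquare.
Variables (D : diagram) (o : orientation D).
Local Notation n := (ncross D).
Implicit Types (L : {set 'I_n}) (a b : 'I_n) (v : chain D).

Definition sgn a L : Zc := (-1) ^+ #|[set b in L | (a < b)%N]|.

Lemma sgn_add a b L : a \notin L -> sgn b (a |: L) = (-1) ^+ (b < a)%N * sgn b L.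
Proof.
move=> aL; rewrite /sgn -exprD; congr (_ ^+ _).
rewrite (cardsD1 a) !inE eqxx /=; congr addn; apply: eq_card => x; rewrite !inE.
by have [->|] := eqVneq x a; rewrite ?(negPf aL).
Qed.

Lemma diff_supported L v : supported L v ->
  diff o v = (-1) ^+ nneg o *: \sum_(a | a \notin L) sgn a L *: xi a v.
Proof.
move=> Lv; apply/ffunP=> h; rewrite !ffunE sum_ffunE [_ *: _]big_distrr /=.
transitivity (\sum_(a | a \notin L) \sum_g
    (-1) ^+ nneg o * (sgn a L * ((v g : Zc) * xi_entry a g h))); last first.
  apply: eq_bigr => a _; rewrite !ffunE [_ *: _]big_distrr /= big_distrr /=.
  by apply: eq_bigr.
rewrite exchange_big /=; apply: eq_bigr => g _.
have [gL|/Lv->] := eqVneq (gset g) L; last first.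
  by rewrite mul0r big1 // => a _; rewrite mul0r !mulr0.
rewrite /diff_coef /dbar_coef !big_distrr gL big_mkcondr /=; apply: eq_bigr => a aL.
rewrite /xi_entry gL aL /=; case: ifP => _; last by rewrite !mulr0.
by rewrite -/(sgn a L); ring.
Qed.

(** The two paths around a face of the cube carry opposite signs ([sgn_add]) and,
    the faces being commutative, cancel in pairs.  It suffices to compute on
    generators. *)
Lemma diff_square v : diff o (diff o v) = 0.
Proof.
have [c [c_turn c_edge]] := checkerboard D.
rewrite (chain_delta v) !linear_sum /= big1 // => g _; rewrite !linearZ /=.
suff -> : diff o (diff o (delta g)) = 0 by rewrite scaler0.
set L := gset g; have supp := @supported_delta D g.
rewrite (diff_supported supp) linearZ linear_sum /=.
rewrite (eq_bigr (fun a => (-1) ^+ nneg o *: \sum_(b | b \notin a |: L)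
    (-1) ^+ (b < a)%N *: ((sgn a L * sgn b L) *: xi b (xi a (delta g))))) => [|a aL].
  rewrite -scaler_sumr [X in _ *: (_ *: X)](_ : _ = 0) ?scaler0 //.
  pose t a b := if (a \notin L) && (b \notin L)
    then (sgn a L * sgn b L) *: xi b (xi a (delta g)) else 0.
  have tC a b : a != b -> t a b = t b a.
    move=> ab; rewrite /t andbC; case: ifP => // /andP[bL aL].
    rewrite [sgn a L * _]mulrC; congr (_ *: _).
    apply: (@delta_ind D L (xi b \o xi a) (xi a \o xi b)) => //=.
    - by move=> s w; rewrite !(xi_mulX c_turn c_edge).
    - by move=> s w; rewrite !(xi_mulX c_turn c_edge).
    - exact: (xi_vac_comm c_turn c_edge).
  rewrite -[RHS](alternating_sum tC) big_mkcond /=; apply: eq_bigr => a _.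
  case: ifP => aL; last by rewrite big1 // => b _; rewrite /t aL scaler0.
  rewrite [LHS]big_mkcond [RHS]big_mkcond /=; apply: eq_bigr => b _.
  by rewrite in_setU1 negb_or /t aL; case: (b == a); case: (b \in L); rewrite //= scaler0.
rewrite linearZ /= (diff_supported (supported_xi supp)) scalerA [_ * (-1) ^+ _]mulrC -scalerA.
congr (_ *: _); rewrite scaler_sumr; apply: eq_bigr => b _.
by rewrite sgn_add // !scalerA; congr (_ *: _); ring.
Qed.

End DiffSquare.

(** * Gradings and the filtration by powers of c *)

Section Homogeneous.
Implicit Types (m k : int) (p q : Zc).

Lemma homogeneous0 m : homogeneous m 0.
Proof. by move=> k; rewrite coef0 eqxx. Qed.

Lemma homogeneous1 : homogeneous 0 (1 : Zc).
Proof. by move=> [|k]; rewrite coef1 //= eqxx. Qed.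

Lemma homogeneous_eq m m' p : homogeneous m p -> m = m' -> homogeneous m' p.
Proof. by move=> + <-. Qed.

Lemma homogeneous_cvar : homogeneous 2 cvar.
Proof. by move=> k; rewrite coefX; case: (k =P 1%N) => [->|_] //; rewrite eqxx. Qed.

Lemma homogeneousM m k p q : homogeneous m p -> homogeneous k q -> homogeneous (m + k) (p * q).
Proof.
move=> pm qk l; rewrite coefM => nz.
have /existsP[i /andP[pi qi]] : [exists i : 'I_l.+1, (p`_i != 0) && (q`_(l - i) != 0)].
  apply: contraNT nz => /existsPn none; apply/eqP/big1 => i _; have := none i.
  by rewrite negb_and !negbK => /orP[]/eqP->; rewrite ?mul0r ?mulr0.
rewrite -(pm _ pi) -(qk _ qi) -mulrDr -PoszD subnKC //; have := ltn_ord i; lia.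
Qed.

Lemma homogeneousD m p q : homogeneous m p -> homogeneous m q -> homogeneous m (p + q).
Proof.
move=> pm qm l; rewrite coefD; have [->|/pm //] := eqVneq p`_l 0.
by rewrite add0r; apply: qm.
Qed.

Lemma homogeneous_sum m (I : finType) (Q : pred I) (F : I -> Zc) :
  (forall i, Q i -> homogeneous m (F i)) -> homogeneous m (\sum_(i | Q i) F i).
Proof. by move=> Fm; elim/big_ind: _ => //; [exact: homogeneous0 | exact: homogeneousD]. Qed.

End Homogeneous.

Lemma cards_meet1 (T : finType) (X : {set T}) x : #|X :&: [set x]| = (x \in X).
Proof.
have [xX|xX] := boolP (x \in X).
  by rewrite (setIidPr _) ?sub1set // cards1.
apply: eq_card0 => y; rewrite !inE; have [->|] := eqVneq y x; first by rewrite (negPf xX).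
by rewrite andbF.
Qed.

Lemma card_trace (T : finType) (K I X : {set T}) (p q : T) :
  K :\: I = [set p; q] -> X \subset K ->
  #|X| = (#|X :&: I| + (p \in X) + (p != q) * (q \in X))%N.
Proof.
move=> KI XK; rewrite -(cardsID I X) -addnA; congr addn.
have -> : X :\: I = X :&: [set p; q].
  rewrite -KI; apply/setP=> C; rewrite !inE andbCA.
  by case: (boolP (C \in X)) => [/(subsetP XK)->|]; rewrite ?andbT ?andbF.
have [->|pq] := eqVneq p q; first by rewrite setUid cards_meet1 addn0.
rewrite mul1n setIUr cardsU !cards_meet1.
have -> : X :&: [set p] :&: (X :&: [set q]) = set0.
  apply/setP=> C; rewrite !inE; apply/negP => /andP[/andP[_ /eqP->] /andP[_ /eqP E]].
  by rewrite E eqxx in pq.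
by rewrite cards0 subn0.
Qed.

Section Gradings.
Variables (D : diagram) (o : orientation D).
Local Notation n := (ncross D).
Implicit Types (L : {set 'I_n}) (a b : 'I_n) (v : chain D) (g h : gen D).

Section Colouring.
Variable c : half_edge n -> bool.
Hypothesis c_turn : forall d, c (turn d) = ~~ c d.
Hypothesis c_edge : forall d, c (edge d) = ~~ c d.
Local Notation pt1 a := (inl (arc1 c a) : site D).
Local Notation pt2 a := (inl (arc2 c a) : site D).

(** Only the circles at the crossing a contribute to the change of degree.  A split
    adds one circle and a merge removes one, which together with the shift by
    one accounts for -2 and 0; each X at these circles counts 2, and c occurs only
    in Delta(1), with the term X (x) X. *)
Lemma xi_homogeneous a g h : a \notin gset g -> gset h = a |: gset g ->
  homogeneous (qdeg o g - qdeg o h) (xi_coef g h).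
Proof.
move=> aL hE; rewrite (xi_coefE c_turn c_edge aL hE); case: ifP => [/eqP tr|_]; last first.
  exact: homogeneous0.
set L := gset g in aL hE tr *; set I := untouched a L in tr *.
have [E E'] := touched_circles c_turn c_edge aL.
have EI : circles L :\: I = [set circ L (pt1 a); circ L (pt2 a)].
  by rewrite -E; apply/setP=> C; rewrite !inE; case: (C \in circles L); rewrite ?andbF.
have EI' : circles (a |: L) :\: I = [set circ (a |: L) (pt1 a); circ (a |: L) (pt2 a)].
  rewrite -E'; apply/setP=> C; rewrite !inE.
  by case: (C \in circles (a |: L)); rewrite ?andbT ?andbF.
have cK := card_trace EI (subxx _); have cK' := card_trace EI' (subxx _).
have cX := card_trace EI (gX_sub g).
have XhE : gX h \subset circles (a |: L) by rewrite -hE gX_sub.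
have cX' := card_trace EI' XhE.
have IK : circles L :&: I = I by apply/setIidPr; exact: subsetIl.
have IK' : circles (a |: L) :&: I = I by apply/setIidPr; exact: subsetIr.
have flip := joined_flip c_turn c_edge aL.
rewrite !circ_in IK in cK; rewrite !circ_in IK' in cK'; rewrite -tr in cX'.
rewrite -!joinedE in cK cX; rewrite -!joinedE flip in cK' cX'.
have cL : #|a |: L| = #|L|.+1 by rewrite cardsU1 aL.
rewrite /qdeg hE -/L cL cK cK' cX cX' /surgery_coef.
move: #|I| #|gX g :&: I| #|L| => i x l.
move: (_ (pt1 a) \in gX g) (_ (pt2 a) \in gX g) => p q.
move: (_ (pt1 a) \in gX h) (_ (pt2 a) \in gX h) => p' q'; case: (joined c L a) => /=.
  apply: (homogeneous_eq (m := 2 * (p' + q')%N%:Z - 2 * (nat_of_bool p)%:Z - 2));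
    last by clear; lia.
  by case: p; case: p'; case: q' => /=;
    first [exact: homogeneous0 | exact: homogeneous1 | exact: homogeneous_cvar].
apply: (homogeneous_eq (m := 2 * (nat_of_bool p')%:Z - 2 * (p + q)%N%:Z)); last by clear; lia.
by case: p; case: q; case: p' => /=; first [exact: homogeneous0 | exact: homogeneous1].
Qed.
End Colouring.

Lemma diff_coef_step g h : diff_coef o g h != 0 ->
  hdeg o h = hdeg o g + 1.
Proof.
move=> nz; have [a /andP[aL /eqP hE]] : exists a, (a \notin gset g) && (gset h == a |: gset g).
  apply/existsP; apply: contraNT nz => /existsPn none.
  by rewrite /diff_coef /dbar_coef big_pred0 ?mulr0 // => a; apply/negbTE/none.
by rewrite /hdeg hE cardsU1 aL addnC PoszD addrAC.
Qed.

Lemma diff_coef_homogeneous g h : homogeneous (qdeg o g - qdeg o h) (diff_coef o g h).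
Proof.
have [c [c_turn c_edge]] := checkerboard D.
have sign k : homogeneous 0 ((-1) ^+ k : Zc).
  rewrite -signr_odd; case: (odd k); rewrite ?expr0 ?expr1; last exact: homogeneous1.
  by move=> l; rewrite coefN oppr_eq0; apply: homogeneous1.
rewrite -[_ - _]add0r; apply: homogeneousM (sign _) _.
apply: homogeneous_sum => a /andP[aL /eqP hE]; rewrite -[_ - _]add0r.
by apply: homogeneousM (sign _) _; apply: (xi_homogeneous c_turn c_edge aL hE).
Qed.

Lemma chain_partP j i v :
  reflect (forall g, v g != 0 -> hdeg o g = i /\ homogeneous (j - qdeg o g) (v g))
          (v \in chain_part o j i).
Proof. exact: asboolP. Qed.

Lemma diff_part j i v : v \in chain_part o j i -> diff o v \in chain_part o j (i + 1).
Proof.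
move/chain_partP=> Pv; apply/chain_partP=> h; rewrite ffunE => nz; split.
  have [g /andP[vg gh]] : exists g, (v g != 0) && (diff_coef o g h != 0).
    apply/existsP; apply: contraNT nz => /existsPn none; rewrite big1 // => g _.
    by have := none g; rewrite negb_and !negbK => /orP[]/eqP->; rewrite ?mul0r ?mulr0.
  by rewrite (diff_coef_step gh); have [-> _] := Pv g vg.
apply: homogeneous_sum => g _.
have -> : j - qdeg o h = (j - qdeg o g) + (qdeg o g - qdeg o h) by rewrite addrA subrK.
apply: homogeneousM; last exact: diff_coef_homogeneous.
have [->|/Pv[_]//] := eqVneq (v g) 0; exact: homogeneous0.
Qed.

(** The subgroup c ^ p C(D) for p >= 0, and all of C(D) for p <= 0. *)
Definition cfil (p : int) : {pred chain D} :=
  fun v => `[< forall g (k : nat), k%:Z < p -> (v g : Zc)`_k = 0 >].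

Lemma cfilP p v :
  reflect (forall g (k : nat), k%:Z < p -> (v g : Zc)`_k = 0) (v \in cfil p).
Proof. exact: asboolP. Qed.

Lemma cfil_closed p : zmod_closed (cfil p).
Proof.
split=> [|u v /cfilP Fu /cfilP Fv]; apply/cfilP=> g k kp; rewrite ffunE ?coef0 //.
by rewrite !ffunE coefB Fu // Fv // subrr.
Qed.
HB.instance Definition _ p := GRing.isZmodClosed.Build (chain D) (cfil p) (cfil_closed p).

Lemma cfilS p v : v \in cfil (p + 1) -> v \in cfil p.
Proof. by move/cfilP=> Fv; apply/cfilP=> g k kp; apply: Fv; lia. Qed.

Lemma cfil_le0 p v : p <= 0 -> v \in cfil p.
Proof. by move=> p0; apply/cfilP=> g k kp; lia. Qed.

Lemma cfil_diff p v : v \in cfil p -> diff o v \in cfil p.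
Proof.
move/cfilP=> Fv; apply/cfilP=> h k kp; rewrite ffunE coef_sum big1 // => g _.
rewrite coefM big1 // => i _; rewrite Fv ?mul0r //; have := ltn_ord i; lia.
Qed.

(** In degree j the generator g can only carry the power c ^ k with
    2 k = j - qdeg g, which bounds k. *)
Lemma cfil_bounded j i : exists p : int, forall v,
  v \in chain_part o j i -> v \in cfil p -> v = 0.
Proof.
exists (\sum_g `|j - qdeg o g|%N).+1%:Z => v /chain_partP Pv /cfilP Fv.
apply/ffunP=> g; rewrite ffunE; apply/polyP=> k; rewrite coef0.
apply/eqP/negPn/negP => nz.
have vg : v g != 0 by apply: contraNneq nz => ->; rewrite coef0.
have [_ /(_ k nz) kE] := Pv g vg; case/eqP: nz; apply: Fv.
rewrite (bigD1 g) //=; lia.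
Qed.

(** ** The associated graded complex *)

Definition coef_chain (k : nat) v : chain0 D := [ffun g => (v g : Zc)`_k].

Definition lift_chain (k : nat) (w : chain0 D) : chain D := [ffun g => (w g)%:P * 'X^k : Zc^o].

Lemma coef_chainB k : {morph coef_chain k : u v / u - v}.
Proof. by move=> u v; apply/ffunP=> g; rewrite !ffunE coefB. Qed.

Lemma lift_chainK k : cancel (lift_chain k) (coef_chain k).
Proof. by move=> w; apply/ffunP=> g; rewrite !ffunE coefMXn ltnn subnn coefC eqxx. Qed.

Lemma cfil_succ (k : nat) v : v \in cfil k%:Z -> (v \in cfil (k%:Z + 1)) = (coef_chain k v == 0).
Proof.
move/cfilP=> Fv; apply/cfilP/eqP=> [Fv1|/ffunP v0 g l lk].
  by apply/ffunP=> g; rewrite !ffunE Fv1 //; lia.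
have [->|lk'] := eqVneq l k; first by have := v0 g; rewrite !ffunE.
by apply: Fv; lia.
Qed.

(** In filtration k, only the constant terms of the matrix of d contribute to
    the coefficient of c ^ k. *)
Lemma coef_diff (k : nat) v : v \in cfil k%:Z -> coef_chain k (diff o v) = diff0 o (coef_chain k v).
Proof.
move/cfilP=> Fv; apply/ffunP=> h; rewrite !ffunE coef_sum; apply: eq_bigr => g _.
rewrite coefM big_ord_recr /= subnn big1 ?add0r => [|i _]; last first.
  by rewrite Fv ?mul0r; [|exact: ltn_ord].
by rewrite ffunE horner_coef0.
Qed.

Lemma chain0_partP j i (w : chain0 D) :
  reflect (forall g, w g != 0 -> hdeg o g = i /\ qdeg o g = j) (w \in chain0_part o j i).
Proof. exact: asboolP. Qed.

Lemma coef_part (k : nat) j i v : v \in chain_part o j i ->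
  coef_chain k v \in chain0_part o (j - 2 * k%:Z) i.
Proof.
move/chain_partP=> Pv; apply/chain0_partP=> g; rewrite ffunE => nz.
have [|-> /(_ k nz) ->] := Pv g; first by apply: contraNneq nz => ->; rewrite coef0.
by rewrite subKr.
Qed.

Lemma lift_part (k : nat) j i w : w \in chain0_part o (j - 2 * k%:Z) i ->
  lift_chain k w \in chain_part o j i.
Proof.
move/chain0_partP=> Pw; apply/chain_partP=> g; rewrite ffunE => nz.
have [|-> ->] := Pw g; first by apply: contraNneq nz => ->; rewrite mul0r.
split=> // l; rewrite subKr coefMXn coefC.
case: ltngtP => // [lk|->]; last by [].
by rewrite subn_eq0 leqNgt lk eqxx.
Qed.

Lemma lift_cfil (k : nat) w : lift_chain k w \in cfil k%:Z.
Proof. by apply/cfilP=> g l lk; rewrite ffunE coefMXn ifT. Qed.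

(** The coefficient of c ^ k kills c ^ (k+1) C(D) and is split by [lift_chain], so
    it identifies the k-th graded piece with C(D) (x)_R Z. *)
Lemma first_page (k : nat) (s j : int) :
  add_iso (page (diff o) (chain_part o j) cfil 1 k%:Z (s - k%:Z)) (coh0 o s (j - 2 * k%:Z)).
Proof.
rewrite /page (_ : k%:Z + (s - k%:Z) = s); last by rewrite addrC subrK.
apply: (subquo_iso (f := coef_chain k)).
- by move=> u v _ _; apply: coef_chainB.
- move=> v /cycP[Pv Fv dFv]; have dv0 : diff0 o (coef_chain k v) = 0.
    by rewrite -coef_diff //; apply/eqP; rewrite -cfil_succ // cfil_diff.
  by apply/cocycleP; split; first exact: coef_part.
- move=> w /cocycleP[Pw dw]; change (diff0 o w = 0) in dw.
  exists (lift_chain k w); last by rewrite lift_chainK subrr rpred0.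
  apply/cycP; split; [exact: lift_part | exact: lift_cfil |].
  by rewrite cfil_succ ?cfil_diff ?lift_cfil // coef_diff ?lift_cfil // lift_chainK dw.
move=> v /cycP[Pv Fv dFv]; apply/asboolP/bndP.
  case=> w Pw dw; change (diff0 o w = coef_chain k v) in dw; exists (lift_chain k w).
    apply/cycP; split; [exact: lift_part | by rewrite subrK lift_cfil |].
    by rewrite cfil_diff ?lift_cfil.
  have dP := diff_part (lift_part Pw); rewrite subrK in dP.
  apply/cycP; split; first exact: rpredB.
    rewrite cfil_succ ?rpredB ?cfil_diff ?lift_cfil // coef_chainB.
    by rewrite coef_diff ?lift_cfil // lift_chainK dw subrr.
  by rewrite raddfB /= diff_square subr0.
case=> z /cycP[Pz + dFz]; rewrite subrK => Fz /cycP[_ Fvz _].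
exists (coef_chain k z); first exact: coef_part.
change (diff0 o (coef_chain k z) = coef_chain k v).
rewrite -coef_diff //; apply/eqP; rewrite eq_sym -subr_eq0 -coef_chainB -cfil_succ //.
exact: cfilS.
Qed.

End Gradings.

Theorem mainTheorem6 (D : diagram) (o : orientation D) (j : int) :
  exists E : spectral_sequence,
    [/\ forall (k : nat) (s : int),
          add_iso (ss_E E 1 k%:Z (s - k%:Z)) (coh0 o s (j - 2 * k%:Z)),
        forall p q : int, p < 0 -> forall x : ss_E E 1 p q, x = 0
      & converges E (fun i => coh o i j)].
Proof.
have FilB := @cfil_bounded D o j.
exists (filtration_ss (P := chain_part o j) (@diff_square D o) (@diff_part D o j)
          (@cfilS D)).
split=> [k s|p q p0|]; first exact: first_page.
  exact: (page_lt0 (@cfil_le0 D) p0).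
by apply: filtration_ss_converges; [exact: cfil_le0 | exact: FilB].
Qed.
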